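(* Let $\epsilon>0$ and $L_f>0$ be given. Suppose an algorithm is applied to problem (P) that satisfies Assumption 1 and generates a sequence $\{x^{(t)}\}_{t\ge0}$ that satisfies Assumption 2. Then for any $\omega\in[0,\frac{150\pi\epsilon}{L_f})$, there exists an instance of problem (P), namely instance $\mathcal P$, such that the algorithm requires at least $$\left\lceil \frac{\kappa([\bar A;A])\,L_f\,\Delta_{F_0}}{36000\pi^2}\,\epsilon^{-2}\right\rceil$$ oracles to obtain a point that is $\omega$-close to an $\epsilon$-stationary point of instance $\mathcal P$, where $\Delta_{F_0}=F_0(x^{(0)})-\inf_x F_0(x)$.
   Context: **Problem (P).** $\min_{x\in\mathbb R^d}F_0(x):=f_0(x)+g(x)$ s.t. $Ax+b=0$, with $A\in\mathbb R^{n\times d}$, $b\in\mathbb R^n$, $f_0:\mathbb R^d\to\mathbb R$ smooth, $g:\mathbb R^d\to\mathbb R\cup\{+\infty\}$ proper lower semicontinuous convex, potentially non-smooth. **Assumption 1.** (a) $\nabla f_0$ is $L_f$-Lipschitz continuous; (b) $\inf_xF_0(x)>-\infty$; (c) $g(x)=\bar g(\bar Ax+\bar b)$ with $\bar A\in\mathbb R^{\bar n\times d}$, $\bar b\in\mathbb R^{\bar n}$, $\bar g:\mathbb R^{\bar n}\to\mathbb R\cup\{+\infty\}$ proper lower semicontinuous convex, potentially non-smooth. **$\epsilon$-stationary point of (P).** $x^*$ such that for some $\gamma\in\mathbb R^n$, $\max\{\mathrm{dist}(0,\nabla f_0(x^* )+A^\top\gamma+\partial g(x^* )),\|Ax^*+b\|\}\le\epsilon$.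 A point $x$ is $\omega$-close to $x^*$ if $\|x-x^*\|\le\omega$. **Assumption 2 (linear span).** There is an oracle that, given any $x,\xi\in\mathbb R^d$, returns $(A^\top b,\nabla f_0(x),A^\top Ax)$ and $\mathrm{prox}_{\eta g}(\xi)$ for any $\eta>0$, where $\mathrm{prox}_{\eta g}(x)=\arg\min_{x'}\{g(x')+\frac1{2\eta}\|x'-x\|^2\}$. The sequence generated by the algorithm satisfies, for all $t\ge1$, $x^{(t)}\in\mathrm{span}(\{\xi^{(t)},\zeta^{(t)}\})$, where $\xi^{(t)}\in\mathrm{span}\big(\{A^\top b\}\cup\bigcup_{s=0}^{t-1}\{x^{(s)},\nabla f_0(x^{(s)}),A^\top Ax^{(s)}\}\big)$ and $\zeta^{(t)}\in\{\mathrm{prox}_{\eta g}(\xi^{(t)}):\eta>0\}$. The point $x^{(t)}$ is generated by the $t$-th iteration, and each iteration calls the oracle once. **Condition number.** $[\bar A;A]$ is the vertical stacking; $\kappa(M)=\sqrt{\lambda_{\max}(MM^\top)/\lambda_{\min}(MM^\top)}$, where $\lambda_{\max}$ is the largest and $\lambda_{\min}$ the smallest positive eigenvalue. **Instance $\mathcal P$.** Parameters $\epsilon>0$, $L_f>0$; integers $m_1\ge2$ even, $m_2\ge1$, $\bar d\ge5$ odd. Put $m=3m_1m_2$, $d=m\bar d$, $\mathcal M=\{im_1:i=1,\dots,3m_2-1\}$, $\mathcal M^C=\{1,\dots,m-1\}\setminus\mathcal M$, $n=(m-3m_2)\bar d$, $\bar n=(3m_2-1)\bar d$. Write $x=(x_1^\top,\dots,x_m^\top)^\top\in\mathbb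 R^d$, $x_i\in\mathbb R^{\bar d}$. $J_m\in\mathbb R^{(m-1)\times m}$ has $(J_m)_{i,i}=-1$, $(J_m)_{i,i+1}=1$, other entries $0$; $J_{\mathcal M},J_{\mathcal M^C}$ are its rows indexed by $\mathcal M,\mathcal M^C$. $\bar A=mL_fJ_{\mathcal M}\otimes I_{\bar d}$, $A=mL_fJ_{\mathcal M^C}\otimes I_{\bar d}$, $b=0$, $\bar b=0$. $\bar g(y)=\frac{\beta}{mL_f}\|y\|_1$, $g(x)=\bar g(\bar Ax)=\beta\sum_{i\in\mathcal M}\|x_i-x_{i+1}\|_1$, with $\beta$ a constant satisfying $\beta>(50\pi+1+\|A\|)\sqrt m\,\epsilon$. $\Psi(u)=0$ for $u\le0$, $\Psi(u)=1-e^{-u^2}$ for $u>0$; $\Phi(v)=4\arctan v+2\pi$. For $z\in\mathbb R^{\bar d}$: $\varphi(z,1)=-\Psi(1)\Phi([z]_1)$; $\varphi(z,j)=\Psi(-[z]_{j-1})\Phi(-[z]_j)-\Psi([z]_{j-1})\Phi([z]_j)$ for $j=2,\dots,\bar d$, where $[z]_j$ is the $j$-th coordinate. $h_i(z)=\varphi(z,1)+3\sum_{j=1}^{\lfloor\bar d/2\rfloor}\varphi(z,2j)$ for $1\le i\le\frac m3$; $h_i(z)=\varphi(z,1)$ for $\frac m3+1\le i\le\frac{2m}3$; $h_i(z)=\varphi(z,1)+3\sum_{j=1}^{\lfloor\bar d/2\rfloor}\varphi(z,2j+1)$ for $\frac{2m}3+1\le i\le m$. $f_i(z)=\frac{300\pi\epsilon^2}{mL_f}h_i\big(\frac{\sqrt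 mL_fz}{150\pi\epsilon}\big)$ and $f_0(x)=\sum_{i=1}^mf_i(x_i)$. **Convention on the starting point.** The starting point $x^{(0)}$ is arbitrary. The instance is written for $x^{(0)}=0$, which is assumed without loss of generality: if $x^{(0)}\ne0$, the variable $x$ in instance $\mathcal P$ is changed to $x-x^{(0)}$, so that the instance becomes $\min_xf_0(x-x^{(0)})+g(x-x^{(0)})$ s.t. $A(x-x^{(0)})+b=0$. *)

(* Defs.v *)
From HB Require Import structures.
From mathcomp Require Import all_boot all_order all_algebra.
From mathcomp Require Import mxtens.
From mathcomp Require Import all_classical all_reals all_analysis.

Set Implicit Arguments.
Unset Strict Implicit.
Unset Printing Implicit Defensive.

Import Order.TTheory GRing.Theory Num.Theory.
Import numFieldNormedType.Exports.

Local Open Scope classical_set_scope.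
Local Open Scope ring_scope.

Section Euclidean.
Context {R : realType}.

Definition dotv {k : nat} (x y : 'cV[R]_k) : R := \sum_i x i 0 * y i 0.

(* The library norm `|x| on matrices is the max norm, hence enorm. *)
Definition enorm {k : nat} (x : 'cV[R]_k) : R := Num.sqrt (\sum_i x i 0 ^+ 2).

Definition l1norm {k : nat} (x : 'cV[R]_k) : R := \sum_i `|x i 0|.

Definition spectral_norm {k l : nat} (M : 'M[R]_(k, l)) : R :=
  sup [set enorm (M *m x) | x in [set x : 'cV[R]_l | enorm x <= 1]].

Definition lambda_max {k : nat} (S : 'M[R]_k) : R :=
  sup [set a | eigenvalue S a].

Definition lambda_min_pos {k : nat} (S : 'M[R]_k) : R :=
  inf [set a | eigenvalue S a /\ 0 < a].

Definition kappa {k l : nat} (M : 'M[R]_(k, l)) : R :=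
  Num.sqrt (lambda_max (M *m M^T) / lambda_min_pos (M *m M^T)).

Definition gradient {k : nat} (f : 'cV[R]_k -> R) (x : 'cV[R]_k) : 'cV[R]_k :=
  \col_i 'D_(delta_mx i 0) f x.

End Euclidean.

Section Convex.
Context {R : realType} {k : nat}.
Implicit Types g : 'cV[R]_k -> \bar R.

Definition proper g : Prop :=
  (forall x, -oo < g x)%E /\ exists x, (g x < +oo)%E.

Definition econvex g : Prop :=
  forall (x y : 'cV[R]_k) (t : R), 0 < t < 1 ->
    (g (t *: x + (1 - t) *: y)%R <= t%:E * g x + (1 - t)%R%:E * g y)%E.

Definition proper_lsc_convex g : Prop :=
  [/\ proper g, lower_semicontinuous g & econvex g].

(* For proper g this set is empty wherever g is +oo. *)
Definition subdiff g (x : 'cV[R]_k) : set 'cV[R]_k :=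
  [set v | forall y, (g x + (dotv v (y - x))%R%:E <= g y)%E].

(* The set of minimizers; a singleton when g is proper, lsc and convex. *)
Definition prox (eta : R) g (xi : 'cV[R]_k) : set 'cV[R]_k :=
  [set z | forall z', (g z + ((2 * eta)^-1 * enorm (z - xi) ^+ 2)%R%:E
                       <= g z' + ((2 * eta)^-1 * enorm (z' - xi) ^+ 2)%R%:E)%E].

End Convex.

(* min f0 x + g x  subject to  A x + b = 0,
   where g is meant to be gbar (Abar x + bbar): see structural_assumption. *)
Record problem (R : realType) (d n nbar : nat) := Problem {
  f0_ : 'cV[R]_d -> R;
  g_ : 'cV[R]_d -> \bar R;
  A_ : 'M[R]_(n, d);
  b_ : 'cV[R]_n;
  gbar_ : 'cV[R]_nbar -> \bar R;
  Abar_ : 'M[R]_(nbar, d);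
  bbar_ : 'cV[R]_nbar }.

Section Problem.
Context {R : realType} {d n nbar : nat}.
Implicit Types P : problem R d n nbar.

Definition F0 P (x : 'cV[R]_d) : \bar R := ((f0_ P x)%:E + g_ P x)%E.

Definition is_problem P : Prop :=
  [/\ forall x, differentiable (f0_ P) x,
      continuous (gradient (f0_ P)) &
      proper_lsc_convex (g_ P)].

Definition structural_assumption (Lf : R) P : Prop :=
  [/\ forall x y, enorm (gradient (f0_ P) x - gradient (f0_ P) y)
                  <= Lf * enorm (x - y),
      (-oo < ereal_inf (range (F0 P)))%E,
      forall x, g_ P x = gbar_ P (Abar_ P *m x + bbar_ P) &
      proper_lsc_convex (gbar_ P)].

(* dist(0, emptyset) = +oo, which is the value of ereal_inf set0. *)
Definition eps_stationary (eps : R) P (x : 'cV[R]_d) : Prop :=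
  exists gamma : 'cV[R]_n,
    (maxe (ereal_inf
             [set (enorm (gradient (f0_ P) x + (A_ P)^T *m gamma + v))%R%:E
               | v in subdiff (g_ P) x])
          (enorm (A_ P *m x + b_ P))%R%:E
     <= eps%:E)%E.

Definition omega_close (omega : R) (x xstar : 'cV[R]_d) : Prop :=
  enorm (x - xstar) <= omega.

Definition oracle_answers P (x : nat -> 'cV[R]_d) (t : nat) : seq 'cV[R]_d :=
  (A_ P)^T *m b_ P
  :: flatten [seq [:: x s; gradient (f0_ P) (x s); (A_ P)^T *m (A_ P *m x s)]
                | s <- iota 0 t].

(* x t is the output of iteration t, and each iteration calls the oracle once,
   so t counts the oracle calls made to obtain x t. *)
Definition linear_span_assumption P (x : nat -> 'cV[R]_d) : Prop :=
  forall t : nat, (1 <= t)%N ->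
    exists xi zeta : 'cV[R]_d,
      [/\ xi \in <<oracle_answers P x t>>%VS,
          exists2 eta : R, 0 < eta & prox eta (g_ P) xi zeta &
          x t \in <<[:: xi; zeta]>>%VS].

(* The problem obtained by replacing the variable x by x - x0; in particular
   A (x - x0) + b = A x + (b - A x0).  The linear span condition is not
   invariant under this translation: for a sequence x started at x0 and run on
   recenter x0 P, it is imposed in the normalized variable x - x0, i.e. on P
   and the sequence x t - x0, which starts at 0. *)
Definition recenter (x0 : 'cV[R]_d) P : problem R d n nbar :=
  {| f0_ := fun x => f0_ P (x - x0);
     g_ := fun x => g_ P (x - x0);
     A_ := A_ P;
     b_ := b_ P - A_ P *m x0;
     gbar_ := gbar_ P;
     Abar_ := Abar_ P;
     bbar_ := bbar_ P - Abar_ P *m x0 |}.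

Definition Delta_F0 P (x0 : 'cV[R]_d) : R :=
  fine (F0 P x0 - ereal_inf (range (F0 P)))%E.

End Problem.

Section HardFunctions.
Context {R : realType}.

Definition Psi (u : R) : R := if u <= 0 then 0 else 1 - expR (- u ^+ 2).

Definition Phi (v : R) : R := 4 * atan v + 2 * pi.

(* [z]_j with 1-based j (and 0 when j is out of range) *)
Definition coord1 {k : nat} (z : 'cV[R]_k) (j : nat) : R :=
  if insub j.-1 is Some i then z i 0 else 0.

Definition varphi {k : nat} (z : 'cV[R]_k) (j : nat) : R :=
  if j == 1%N then - Psi 1 * Phi (coord1 z 1)
  else Psi (- coord1 z j.-1) * Phi (- coord1 z j)
       - Psi (coord1 z j.-1) * Phi (coord1 z j).

(* h_i with 1-based i, out of m functions *)
Definition hfun (m i : nat) {dbar : nat} (z : 'cV[R]_dbar) : R :=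
  if (i <= m %/ 3)%N then
    varphi z 1 + 3 * \sum_(1 <= j < (dbar %/ 2).+1) varphi z (2 * j)%N
  else if (i <= (2 * m) %/ 3)%N then varphi z 1
  else
    varphi z 1 + 3 * \sum_(1 <= j < (dbar %/ 2).+1) varphi z (2 * j).+1.

Definition fi (eps Lf : R) (m i : nat) {dbar : nat} (z : 'cV[R]_dbar) : R :=
  300 * pi * eps ^+ 2 / (m%:R * Lf)
  * hfun m i ((Num.sqrt m%:R * Lf / (150 * pi * eps)) *: z).

(* x_i, for 0-based i; mxtens_index (i, j) is i * dbar + j, the indexing that
   the Kronecker product tensmx uses. *)
Definition blk {m dbar : nat} (x : 'cV[R]_(m * dbar)) (i : 'I_m) :
  'cV[R]_dbar := \col_j x (mxtens_index (i, j)) 0.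

(* Rows of J_m whose 1-based indices are listed in s; column j : 'I_m has
   1-based index j.+1. *)
Definition Jrows (m : nat) (s : seq nat) (k : nat) : 'M[R]_(k, m) :=
  \matrix_(r < k, j < m)
    (if j.+1 == nth 0%N s r then -1
     else if j.+1 == (nth 0%N s r).+1 then 1 else 0).

End HardFunctions.

Definition nblocks (m1 m2 : nat) : nat := (3 * m1 * m2)%N.

Definition calM (m1 m2 : nat) : seq nat :=
  [seq (i * m1)%N | i <- iota 1 (3 * m2 - 1)].

Definition calMC (m1 m2 : nat) : seq nat :=
  [seq i <- iota 1 (nblocks m1 m2 - 1) | i \notin calM m1 m2].

Section Instance.
Context {R : realType}.
Variables (eps Lf : R) (m1 m2 dbar : nat) (beta : R).

Local Notation m := (nblocks m1 m2).

Definition instAbar : 'M[R]_((3 * m2 - 1) * dbar, m * dbar) :=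
  (m%:R * Lf) *: tensmx (Jrows m (calM m1 m2) (3 * m2 - 1)) (1%:M : 'M[R]_dbar).

Definition instA : 'M[R]_((m - 3 * m2) * dbar, m * dbar) :=
  (m%:R * Lf) *: tensmx (Jrows m (calMC m1 m2) (m - 3 * m2)) (1%:M : 'M[R]_dbar).

Definition instgbar (y : 'cV[R]_((3 * m2 - 1) * dbar)) : \bar R :=
  (beta / (m%:R * Lf) * l1norm y)%:E.

Definition instP :
  problem R (m * dbar) ((m - 3 * m2) * dbar) ((3 * m2 - 1) * dbar) :=
  {| f0_ := fun x => \sum_(i < m) fi eps Lf m i.+1 (blk x i);
     g_ := fun x => instgbar (instAbar *m x);
     A_ := instA;
     b_ := 0;
     gbar_ := instgbar;
     Abar_ := instAbar;
     bbar_ := 0 |}.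

End Instance.

(* Main.v *)
(* Index entries by (block, coordinate).  Each f_i is a chain in which
   coordinate j of a block can become nonzero only after coordinate j-1 of the
   same block, and the chain links of even index live in the first third of the
   blocks, those of odd index in the last third.  One oracle call moves a nonzero
   entry by at most two blocks (one by A^T A, one by the prox of g), so about
   (dbar - 2) m / 6 calls are needed before the last coordinate is nonzero
   anywhere.  Conversely, at an eps-stationary point the penalty beta is exact, all
   blocks are equal across calM and nearly equal elsewhere, and testing
   stationarity along vectors that are constant over blocks shows that every
   scaled coordinate of every block is at least 1 in absolute value, so the last
   coordinate cannot vanish at an omega-close point.  The bound then follows from
   kappa <= 2 m (discrete Poincare inequality) and
   Delta <= 1200 pi^2 eps^2 dbar / Lf. *)
Require Import Defs.
From HB Require Import structures.
From mathcomp Require Import all_boot all_order all_algebra.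
From mathcomp Require Import all_classical all_reals all_analysis.
From mathcomp Require Import mxtens ring lra zify.

Set Implicit Arguments.
Unset Strict Implicit.
Unset Printing Implicit Defensive.

Import Order.TTheory GRing.Theory Num.Theory.
Import numFieldNormedType.Exports.

Local Open Scope classical_set_scope.
Local Open Scope ring_scope.

(** * Psi, Phi and the two-variable chain link *)

Section ScalarFunctions.
Context {R : realType}.
Implicit Types a b x y : R.

(** At a stationary point [gamma] and the subgradient of [g] can offset the gradient block by block;
    what survives unspoiled is its sum over all blocks. In that sum each coordinate must count as
    much as in an ordinary chain function although its link is present in only a third of the
    blocks, which is why the links carry weight 3. Such a sum can be evaluated only if the blocks
    agree closely enough to be replaced by one of them; the penalty and the factor m * Lf in the
    constraints provide this. In units of sqrt m * eps the constants close as follows: where a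
    scaled coordinate is below 1 and its predecessor is at least 1 in absolute value, the total
    derivative with all blocks frozen is below - 21/10, freezing costs at most 1, and stationarity
    allows 11/10. On the algorithmic side, passing along an active link costs nothing; the whole
    cost lies in carrying an entry through the middle third, where only the first link is
    present. *)

Lemma lipschitz_of_derive (f df : R -> R) (K : R) :
  (forall x, is_derive x 1 f (df x)) -> (forall x, `|df x| <= K) ->
  forall x y, `|f x - f y| <= K * `|x - y|.
Proof.
move=> fdf dfK.
have main x y : x <= y -> `|f y - f x| <= K * `|y - x|.
  move=> xy.
  have cf : {within `[x, y], continuous f}.
    by apply: derivable_within_continuous => z _; have [] := fdf z.
  have [c _ ->] := MVT_segment xy (fun z _ => fdf z) cf.
  by rewrite normrM ler_wpM2r.
move=> x y; have [xy|/ltW yx] := leP x y; last exact: main.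
by rewrite distrC (distrC x y); exact: main.
Qed.

(** Meant for [Psi] at 0, where its two branches meet and no neighbourhood lies inside one of them;
    a quadratic remainder settles that point. *)
Lemma is_derive_quadratic (f : R -> R) x (d C : R) :
  (forall h, `|f (x + h) - f x - d * h| <= C * h ^+ 2) -> is_derive x 1 f d.
Proof.
move=> H.
have C0 : 0 <= C.
  by have := le_trans (normr_ge0 _) (H 1); rewrite expr1n mulr1.
have cv : h^-1 *: ((f \o shift x) (h *: 1) - f x) @[h --> 0^'] --> d.
  apply/cvgrPdist_le => e e0.
  have C1 : 0 < C + 1 by lra.
  near=> h.
  have h0 : h != 0 by near: h; exact: nbhs_dnbhs_neq.
  rewrite /= /GRing.scale /= mulr1 (addrC h) distrC.
  have -> : h^-1 * (f (x + h) - f x) - d = h^-1 * (f (x + h) - f x - d * h).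
    by field.
  rewrite normrM normfV.
  have hp : 0 < `|h| by rewrite normr_gt0.
  rewrite ler_pdivrMl // (le_trans (H h)) // -(real_normK (num_real h)) expr2.
  have : `|h| <= e / (C + 1).
    near: h; apply: dnbhs0_le; exact: divr_gt0.
  rewrite ler_pdivlMr // => hC.
  rewrite mulrCA ler_pM2l //.
  nra.
apply: DeriveDef; first by apply/cvg_ex; exists d.
exact: (cvg_lim (@norm_hausdorff _ _) cv).
Unshelve. all: by end_near. Qed.

Definition dPsi a : R := if a <= 0 then 0 else 2 * a * expR (- a ^+ 2).

Definition dPhi b : R := 4 / (1 + b ^+ 2).

Lemma is_derive_Phi b : is_derive b 1 Phi (dPhi b).
Proof.
have -> : @Phi R = (4 \*: (@atan R : R -> R^o)) + cst (2 * pi) by [].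
by apply: is_derive_eq; rewrite addr0.
Qed.

Lemma is_derive_expRNsq x :
  is_derive x 1 (fun a => expR (- a ^+ 2)) (- (2 * x * expR (- x ^+ 2))).
Proof.
have -> : (fun a : R => expR (- a ^+ 2)) = expR \o (- (id ^+ 2)) by [].
apply: is_derive_eq.
by rewrite /GRing.scale /= mulr1 expr1; ring.
Qed.

Lemma is_derive_Psi a : is_derive a 1 Psi (dPsi a).
Proof.
have [a0|a0|->] := ltgtP a 0.
- rewrite /dPsi (ltW a0).
  apply: (@near_eq_is_derive _ _ _ (cst 0)).
  near=> y; rewrite /Psi ifT //.
  by apply: ltW; near: y; exact: lt_nbhsl.
- rewrite /dPsi leNgt a0 /=.
  apply: (@near_eq_is_derive _ _ _ (cst 1 - (fun a => expR (- a ^+ 2)))).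
    near=> y; rewrite /Psi leNgt ifF //.
    by apply/negbTE/negPn; near: y; exact: lt_nbhsr.
  have := is_derive_expRNsq a => dE.
  by apply: is_derive_eq; rewrite sub0r opprK.
- rewrite /dPsi lexx.
  apply: (@is_derive_quadratic _ _ _ 1) => h.
  rewrite /Psi lexx add0r mul0r !subr0 mul1r; case: ifPn => h0.
    by rewrite normr0 sqr_ge0.
  have := expR_ge1Dx (- h ^+ 2).
  have : expR (- h ^+ 2) <= 1 by rewrite -expR0 ler_expR oppr_le0 sqr_ge0.
  by move=> *; rewrite ger0_norm; lra.
Unshelve. all: by end_near. Qed.

Lemma dPsi_ge0 a : 0 <= dPsi a.
Proof.
rewrite /dPsi; case: (leP a 0) => // a0.
by have := expR_ge0 (- a ^+ 2); nra.
Qed.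

(** From 2a <= 1 + a^2 <= exp (a^2). *)
Lemma dPsi_le1 a : dPsi a <= 1.
Proof.
rewrite /dPsi; case: (leP a 0) => // a0.
rewrite expRN ler_pdivrMr ?expR_gt0 // mul1r.
apply: le_trans (expR_ge1Dx _); have := sqr_ge0 (a - 1); nra.
Qed.

(** [dPsi] has a kink at 0, so the mean value argument is applied to the smooth function [G], and
    [dPsi] is [G] composed with the 1-Lipschitz map max (x, 0). *)
Lemma dPsi_lipschitz a b : `|dPsi a - dPsi b| <= 2 * `|a - b|.
Proof.
pose G x := 2 * x * expR (- x ^+ 2).
have GE x : dPsi x = G (Num.max x 0).
  rewrite /dPsi /G; case: (leP x 0) => // _; by rewrite mulr0 mul0r.
have dG x : is_derive x 1 G ((2 - 4 * x ^+ 2) * expR (- x ^+ 2)).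
  have -> : G = (2 \*: (id : R -> R^o)) * (fun a => expR (- a ^+ 2)) by [].
  have := is_derive_expRNsq x => dE.
  apply: is_derive_eq; rewrite /GRing.scale /= /GRing.scale /=; ring.
have bG x : `|(2 - 4 * x ^+ 2) * expR (- x ^+ 2)| <= 2.
  rewrite normrM (ger0_norm (expR_ge0 _)) expRN ler_pdivrMr ?expR_gt0 //.
  have x2 := sqr_ge0 x.
  have e1 := expR_ge1Dx (x ^+ 2).
  have e2 := expR_ge1Dxn 1 x2.
  have e3 : 1 + (x ^+ 2) ^+ 2 / 2 <= expR (x ^+ 2) by exact: e2.
  (* With y = x^2: 4y - 2 <= 2 + y^2 <= 2 exp y, the first inequality being (y - 2)^2 >= 0. *)
  have := sqr_ge0 (x ^+ 2 - 2).
  rewrite ler_norml => ?; apply/andP; split; nra.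
rewrite !GE; apply: le_trans (lipschitz_of_derive dG bG _ _) _.
rewrite ler_pM2l //.
have := ler_norm (a - b); have := ler_norm (- (a - b)); rewrite normrN.
case: (leP a 0); case: (leP b 0) => *; rewrite ?subrr ?normr0 //.
- by rewrite sub0r normrN gtr0_norm //; lra.
- by rewrite subr0 gtr0_norm //; lra.
Qed.

Lemma Psi_ge0 a : 0 <= Psi a.
Proof.
rewrite /Psi; case: (leP a 0) => // _.
by rewrite subr_ge0 -expR0 ler_expR oppr_le0 sqr_ge0.
Qed.

Lemma Psi_le1 a : Psi a <= 1.
Proof. by rewrite /Psi; case: (leP a 0) => // _; rewrite gerBl expR_ge0. Qed.

Lemma Psi_le0 a : a <= 0 -> Psi a = 0.
Proof. by rewrite /Psi => ->. Qed.

Lemma dPsi_le0 a : a <= 0 -> dPsi a = 0.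
Proof. by rewrite /dPsi => ->. Qed.

Lemma Psi_lipschitz a b : `|Psi a - Psi b| <= `|a - b|.
Proof.
rewrite -(mul1r `|a - b|); apply: lipschitz_of_derive is_derive_Psi _ _ _ => x.
by rewrite ger0_norm ?dPsi_ge0 ?dPsi_le1.
Qed.

(** Here e >= (3/2)^2 gives 1 - 1/e >= 5/9 > 21/40. The value 21/40 is chosen so that, times the
    lower bound 2 of [dPhi] and the scale 2 of the gradient, it yields 21/10. *)
Lemma Psi_ge1 a : 1 <= a -> 21 / 40 < Psi a.
Proof.
move=> a1; rewrite /Psi leNgt (lt_le_trans ltr01 a1) /=.
have : expR (- a ^+ 2) <= expR (- 1 : R) by rewrite ler_expR; nra.
have h : 1 + 1 / 2 <= expR (1 / 2 : R) by exact: expR_ge1Dx.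
have e1 : expR (1 : R) = expR (1 / 2) ^+ 2.
  by rewrite -expRM_natl -mulr_natl; congr expR; lra.
have e0 : expR (- 1 : R) * expR 1 = 1 by rewrite -expRD addNr expR0.
have := expR_gt0 (- 1 : R).
move: e0; rewrite e1; move: h; set u := expR (1 / 2); set v := expR (- 1).
move=> hu uv vp va.
have u2 : 9 / 4 <= u ^+ 2 by nra.
have h3 : 9 / 4 * v <= 1.
  by rewrite -[leRHS]uv mulrC ler_pM2l.
lra.
Qed.

Lemma dPhi_ge0 b : 0 <= dPhi b.
Proof. by rewrite divr_ge0 // addr_ge0 ?sqr_ge0. Qed.

Lemma dPhi_le4 b : dPhi b <= 4.
Proof.
have b2 := sqr_ge0 b.
have p : 0 < 1 + b ^+ 2 by lra.
by rewrite ler_pdivrMr //; lra.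
Qed.

Lemma dPhiN b : dPhi (- b) = dPhi b.
Proof. by rewrite /dPhi sqrrN. Qed.

Lemma dPhi_lt1 b : `|b| < 1 -> 2 < dPhi b.
Proof.
move=> b1; have b2 : b ^+ 2 < 1.
  by rewrite -real_normK ?num_real // expr_lt1.
have p : 0 < 1 + b ^+ 2 by have := sqr_ge0 b; lra.
by rewrite /dPhi ltr_pdivlMr //; lra.
Qed.

Lemma dPhi_lipschitz a b : `|dPhi a - dPhi b| <= 4 * `|a - b|.
Proof.
have a2 := sqr_ge0 a; have b2 := sqr_ge0 b.
have -> : dPhi a - dPhi b
    = 4 * (a - b) * - ((a + b) / ((1 + a ^+ 2) * (1 + b ^+ 2))).
  by rewrite /dPhi; field; apply/andP; split; apply: lt0r_neq0; lra.
rewrite normrM normrM (ger0_norm (ler0n _ 4)) -[leRHS]mulr1.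
rewrite ler_wpM2l ?mulr_ge0 // normrN normrM normfV.
have p : 0 < (1 + a ^+ 2) * (1 + b ^+ 2) by apply: mulr_gt0; lra.
rewrite (gtr0_norm p) ler_pdivrMr // mul1r.
have := sqr_ge0 (a - 1); have := sqr_ge0 (b - 1).
have := sqr_ge0 (a + 1); have := sqr_ge0 (b + 1).
have := mulr_ge0 a2 b2.
rewrite ler_norml => *; apply/andP; split; nra.
Qed.

Lemma Phi_bounds b : 0 <= Phi b <= 4 * pi.
Proof. by have := atan_gtNpi2 b; have := atan_ltpi2 b; rewrite /Phi; lra. Qed.

Lemma PhiN b : Phi (- b) = 4 * pi - Phi b.
Proof. by rewrite /Phi atanN; lra. Qed.

Lemma Phi_lipschitz a b : `|Phi a - Phi b| <= 4 * `|a - b|.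
Proof.
apply: lipschitz_of_derive is_derive_Phi _ _ _ => x.
by rewrite ger0_norm ?dPhi_ge0 ?dPhi_le4.
Qed.

Definition chi a b : R := Psi (- a) * Phi (- b) - Psi a * Phi b.

(** [chia] and [chib] are the two partial derivatives of [chi]; the terms of [chib] share a factor
    because [dPhi] is even. *)
Definition chia a b : R := - (dPsi (- a) * Phi (- b) + dPsi a * Phi b).

Definition chib a b : R := - ((Psi (- a) + Psi a) * dPhi b).

(** One of [a], [- a] is nonpositive, so at most one term is nonzero and the bound is 1 rather than
    2. *)
Lemma PsiN_addr_ge0 a : 0 <= Psi (- a) + Psi a <= 1.
Proof.
rewrite addr_ge0 ?Psi_ge0 //=; have [a0|/ltW a0] := leP a 0.
  by rewrite (Psi_le0 a0) addr0 Psi_le1.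
by rewrite (@Psi_le0 (- a)) ?add0r ?Psi_le1 // oppr_le0.
Qed.

Lemma dPsiN_addr_ge0 a : 0 <= dPsi (- a) + dPsi a <= 1.
Proof.
rewrite addr_ge0 ?dPsi_ge0 //=; have [a0|/ltW a0] := leP a 0.
  by rewrite (dPsi_le0 a0) addr0 dPsi_le1.
by rewrite (@dPsi_le0 (- a)) ?add0r ?dPsi_le1 // oppr_le0.
Qed.

Lemma chi_ge a b : - (4 * pi) <= chi a b.
Proof.
have := Phi_bounds b; have := Phi_bounds (- b).
have := Psi_ge0 (- a); have := Psi_ge0 a; have := Psi_le1 a.
rewrite /chi => *; nra.
Qed.

(** Both [Psi] and [dPsi] vanish at 0. A link whose first argument is 0 is therefore invisible to
    the gradient, whatever its second argument: this and the next two identities are the zero-chain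
    mechanism. *)
Lemma chi0 b : chi 0 b = 0.
Proof. by rewrite /chi oppr0 /Psi lexx !mul0r subrr. Qed.

Lemma chia0 b : chia 0 b = 0.
Proof. by rewrite /chia oppr0 /dPsi lexx !mul0r addr0 oppr0. Qed.

Lemma chib0 b : chib 0 b = 0.
Proof. by rewrite /chib oppr0 /Psi lexx add0r mul0r oppr0. Qed.

Lemma chia_le0 a b : chia a b <= 0.
Proof.
have /andP[p _] := Phi_bounds b; have /andP[q _] := Phi_bounds (- b).
by rewrite oppr_le0 addr_ge0 ?mulr_ge0 ?dPsi_ge0.
Qed.

Lemma chia_ge a b : - (4 * pi) <= chia a b.
Proof.
have /andP[p p'] := Phi_bounds b; have /andP[q q'] := Phi_bounds (- b).
have := dPsi_ge0 a; have := dPsi_ge0 (- a); have /andP[_ s] := dPsiN_addr_ge0 a.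
rewrite /chia => *; nra.
Qed.

Lemma chib_bounds a b : - 4 <= chib a b <= 0.
Proof.
have /andP[p p'] := PsiN_addr_ge0 a; have := dPhi_ge0 b; have := dPhi_le4 b.
by rewrite /chib => *; apply/andP; split; nra.
Qed.

Lemma chib_lt a b : 1 <= `|a| -> `|b| < 1 -> chib a b < - (21 / 20).
Proof.
move=> a1 b1; rewrite /chib ltrN2.
have P : 21 / 40 < Psi (- a) + Psi a.
  have := Psi_ge0 a; have := Psi_ge0 (- a).
  move: a1; rewrite ler_normr => /orP[] /Psi_ge1; lra.
have := dPhi_lt1 b1; nra.
Qed.

(* The constant 8 pi rather than 16 pi comes from Phi (- b) + Phi b = 4 pi. *)
Lemma chia_lipschitz a b a' b' :
  `|chia a b - chia a' b'| <= 8 * pi * `|a - a'| + 4 * `|b - b'|.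
Proof.
have -> : chia a b - chia a' b' =
  ((dPsi (- a') - dPsi (- a)) * Phi (- b) + (dPsi a' - dPsi a) * Phi b)
  + (dPsi (- a') * (Phi (- b') - Phi (- b)) + dPsi a' * (Phi b' - Phi b)).
  by rewrite /chia; ring.
apply: le_trans (ler_normD _ _) _; apply: lerD.
  apply: le_trans (ler_normD _ _) _; rewrite !normrM.
  have := dPsi_lipschitz (- a') (- a); have := dPsi_lipschitz a' a.
  rewrite (_ : - a' - - a = a - a'); last by ring.
  rewrite (distrC a' a) => d1 d2; have := Phi_bounds b; rewrite PhiN => Pb.
  by rewrite (@ger0_norm _ (Phi b)) ?(@ger0_norm _ (4 * pi - Phi b)); nra.
apply: le_trans (ler_normD _ _) _; rewrite !normrM.
have := Phi_lipschitz (- b') (- b); have := Phi_lipschitz b' b.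
rewrite (_ : - b' - - b = b - b'); last by ring.
rewrite (distrC b' b) => d1 d2.
have := dPsiN_addr_ge0 a'; have p0 := dPsi_ge0 a'; have p1 := dPsi_ge0 (- a').
rewrite (ger0_norm p0) (ger0_norm p1).
have := normr_ge0 (b - b'); nra.
Qed.

Lemma chib_lipschitz a b a' b' :
  `|chib a b - chib a' b'| <= 4 * `|a - a'| + 4 * `|b - b'|.
Proof.
(* Merging the two terms into one value of [Psi] lets the Lipschitz constant 1 of [Psi] be used once
   instead of twice. *)
have PE x : Psi (- x) + Psi x = Psi `|x|.
  have [x0|x0] := leP 0 x.
    by rewrite ger0_norm // (@Psi_le0 (- x)) ?add0r // oppr_le0.
  by rewrite ltr0_norm // (@Psi_le0 x) ?addr0 // ltW.
have -> : chib a b - chib a' b' =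
  (Psi `|a'| - Psi `|a|) * dPhi b + Psi `|a'| * (dPhi b' - dPhi b).
  by rewrite /chib !PE; ring.
apply: le_trans (ler_normD _ _) _; rewrite (normrM (_ - _)) (normrM (Psi _)); apply: lerD.
  have d1 : `|Psi `|a'| - Psi `|a| | <= `|a - a'|.
    apply: le_trans (Psi_lipschitz _ _) _.
    by apply: le_trans (ler_dist_dist _ _) _; rewrite distrC.
  rewrite (ger0_norm (dPhi_ge0 _)).
  have := dPhi_ge0 b; have := dPhi_le4 b; have := normr_ge0 (Psi `|a'| - Psi `|a|).
  nra.
rewrite (ger0_norm (Psi_ge0 _)) -(mul1r (4 * _)) ler_pM ?Psi_ge0 ?Psi_le1 //.
by rewrite distrC dPhi_lipschitz.
Qed.

End ScalarFunctions.

(** * Block entries and chain weights *)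

Section Entries.
Context {R : realType}.
Variables m d : nat.
Implicit Types x y : 'cV[R]_(m * d).

(** Indices are natural numbers, with value 0 out of range, so that shifts such as [s.-1] and [j.+1]
    need no ordinal casts and the chain can run one entry past its end. *)
Definition ent x (i j : nat) : R :=
  if insub i is Some i' then
    if insub j is Some j' then x (mxtens_index (i', j')) 0 else 0
  else 0.

Lemma entE x (i : 'I_m) (j : 'I_d) : ent x i j = x (mxtens_index (i, j)) 0.
Proof. by rewrite /ent !valK. Qed.

Lemma ent_out x i j : (d <= j)%N -> ent x i j = 0.
Proof.
move=> dj; rewrite /ent; case: insubP => // i' _ _.
by rewrite insubF // ltnNge dj.
Qed.

Lemma entD x y i j : ent (x + y) i j = ent x i j + ent y i j.
Proof.
by rewrite /ent; do 2?[case: insubP => [? _ _|_]]; rewrite ?addr0 // mxE.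
Qed.

Lemma entZ (a : R) x i j : ent (a *: x) i j = a * ent x i j.
Proof.
by rewrite /ent; do 2?[case: insubP => [? _ _|_]]; rewrite ?mulr0 // mxE.
Qed.

Lemma ent0 i j : ent (0 : 'cV[R]_(m * d)) i j = 0.
Proof. by rewrite -(scale0r 0) entZ mul0r. Qed.

Lemma entN x i j : ent (- x) i j = - ent x i j.
Proof. by rewrite -scaleN1r entZ mulN1r. Qed.

Lemma entB x y i j : ent (x - y) i j = ent x i j - ent y i j.
Proof. by rewrite entD entN. Qed.

Lemma ent_delta (i0 : 'I_m) (j0 : 'I_d) i j :
  ent (delta_mx (mxtens_index (i0, j0)) 0) i j = ((i == i0) && (j == j0))%:R.
Proof.
have [im|im] := ltnP i m; last first.
  rewrite /ent insubF ?(ltnNge i) ?im // gtn_eqF //.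
  exact: leq_trans (ltn_ord i0) im.
have [jd|jd] := ltnP j d; last first.
  by rewrite ent_out // (gtn_eqF (leq_trans (ltn_ord j0) jd)) andbF.
rewrite (entE _ (Ordinal im) (Ordinal jd)) mxE andbT.
by rewrite (inj_eq (can_inj (@mxtens_indexK _ _))).
Qed.

Lemma is_diff_ent x i j :
  is_diff x (fun y => ent y i j) (fun h => ent h i j).
Proof.
have lin : linear (fun y => ent y i j : R^o).
  by move=> a u v /=; rewrite entD entZ.
pose L := GRing.isLinear.Build _ _ _ _ _ lin.
pose f : {linear 'cV[R]_(m * d) -> R^o} := HB.pack (fun y => ent y i j : R^o) L.
have cf : continuous f.
  rewrite /f /= /ent; case: insubP => [i' _ _|_]; last exact: cst_continuous.
  by case: insubP => [j' _ _|_]; [exact: coord_continuous|exact: cst_continuous].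
by have := diff_lin x cf; have := linear_differentiable x cf; split.
Qed.

Lemma sum_mxtens (F : 'I_(m * d) -> R) :
  \sum_k F k = \sum_(i < m) \sum_(j < d) F (mxtens_index (i, j)).
Proof.
rewrite pair_big /= (reindex (@mxtens_index m d)) /=.
  by apply: eq_bigr => -[].
by exists (@mxtens_unindex m d) => k _; rewrite (mxtens_indexK, mxtens_unindexK).
Qed.

Lemma ent_inj x y :
  (forall (i : 'I_m) (j : 'I_d), ent x i j = ent y i j) -> x = y.
Proof.
move=> xy; apply/colP => k; rewrite -[k]mxtens_unindexK.
by case: (mxtens_unindex k) => i j; rewrite -!entE.
Qed.

Lemma enorm_ge0 k (z : 'cV[R]_k) : 0 <= enorm z.
Proof. exact: sqrtr_ge0. Qed.

Lemma sqr_enorm_dot k (z : 'cV[R]_k) : enorm z ^+ 2 = \sum_i z i 0 ^+ 2.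
Proof. by rewrite sqr_sqrtr // sumr_ge0 // => i _; exact: sqr_ge0. Qed.

Lemma sqr_enorm x :
  enorm x ^+ 2 = \sum_(i < m) \sum_(j < d) ent x i j ^+ 2.
Proof.
rewrite sqr_enorm_dot sum_mxtens; apply: eq_bigr => i _.
by apply: eq_bigr => j _; rewrite entE.
Qed.

Lemma dotv_ent x y :
  dotv x y = \sum_(i < m) \sum_(j < d) ent x i j * ent y i j.
Proof.
rewrite /dotv sum_mxtens; apply: eq_bigr => i _.
by apply: eq_bigr => j _; rewrite !entE.
Qed.

End Entries.

Section Weights.
Context {R : realType}.
Variables q d : nat.

(** Coefficient in block [i] (0-based, out of 3q) of the link from chain entry [j] to [j.+1], that
    is of [varphi z j.+1] in [hfun]; hence odd [j] stands for an even 1-based coordinate. Weight 3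
    on q blocks gives each later link the same total, 3q, as the first link has with weight 1
    everywhere. *)
Definition wt (i j : nat) : R :=
  if (d <= j)%N then 0 else
  if j == 0%N then 1 else
  if ((i < q)%N && odd j) || ((2 * q <= i)%N && ~~ odd j) then 3 else 0.

Lemma wt_ge0 i j : 0 <= wt i j.
Proof. by rewrite /wt; do 3?[case: ifP => // _]. Qed.

Lemma wt_le3 i j : wt i j <= 3.
Proof. by rewrite /wt; do 3?[case: ifP => _]; lra. Qed.

Lemma sum_wt j : (j < d)%N -> \sum_(i < 3 * q) wt i j = (3 * q)%:R.
Proof.
move=> jd; rewrite /wt leqNgt jd /=; case: eqP => [_|_].
  by rewrite sumr_const card_ord.
rewrite -(big_mkord predT (fun i =>
  if (i < q)%N && odd j || (2 * q <= i)%N && ~~ odd j then 3 else 0)).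
rewrite (@big_cat_nat _ _ _ q) //=; last by lia.
rewrite (@big_cat_nat _ _ _ (2 * q) q) //=; [|lia..].
rewrite (@eq_big_nat _ _ _ 0 q _ (fun=> if odd j then 3 else 0)); last first.
  move=> i /andP[_ iq]; rewrite iq /= (_ : (2 * q <= i)%N = false) ?orbF //.
  by apply/negbTE; lia.
rewrite (@eq_big_nat _ _ _ q (2 * q) _ (fun=> 0)); last first.
  move=> i /andP[qi iq]; rewrite ltnNge qi /= leqNgt iq //.
rewrite (@eq_big_nat _ _ _ (2 * q) (3 * q) _ (fun=> if odd j then 0 else 3)); last first.
  move=> i /andP[qi iq]; rewrite qi /= (_ : (i < q)%N = false) /=.
    by case: odd.
  by apply/negbTE; lia.
rewrite !big_const_nat !iter_addr !addr0 mul0rn add0r subn0.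
rewrite (_ : 3 * q - 2 * q = q)%N; last by lia.
by case: odd; rewrite ?mul0rn ?addr0 ?add0r natrM mulr_natr.
Qed.

End Weights.

(** * The functions h_i as weighted sums of chain links *)

Section ChainFunction.
Context {R : realType}.

(** The entry 1 in front turns the special first term into an ordinary link: since [Psi (-1)] is 0,
    [varphi z 1] is [chi 1] at the first coordinate. *)
Definition ext {d} (z : 'cV[R]_d) (j : nat) : R :=
  if j is 0%N then 1 else coord1 z j.

Lemma varphi_chi d (z : 'cV[R]_d) j : varphi z j.+1 = chi (ext z j) (ext z j.+1).
Proof.
case: j => [|j]; rewrite /varphi /chi //=.
by rewrite (@Psi_le0 _ (-1)) ?oppr_le0 // mul0r sub0r mulNr.
Qed.

Lemma sum_pairs (G : nat -> R) e :
  \sum_(j < e.*2.+1) G j =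
  G 0%N + \sum_(1 <= k < e.+1) (G (2 * k).-1 + G (2 * k)%N).
Proof.
elim: e => [|e IH]; first by rewrite big_geq // big_ord1 addr0.
rewrite doubleS 2!big_ord_recr /= IH [in RHS]big_nat_recr //= -!addrA.
by rewrite -mul2n; congr (_ + (_ + (G _ + G _))); lia.
Qed.

(** For odd [d] the links after the first one split into complete pairs (2k - 1, 2k); the first
    third uses one member of each pair, the last third the other. *)
Lemma hfunE q i d (z : 'cV[R]_d) : odd d ->
  hfun (3 * q) i.+1 z = \sum_(j < d) wt q d i j * chi (ext z j) (ext z j.+1).
Proof.
move=> od; have dE : d = (d./2).*2.+1 by rewrite -[LHS]odd_double_half od.
rewrite /hfun (mulKn q (isT : 0 < 3)%N) (_ : 2 * (3 * q) %/ 3 = 2 * q)%N; last first.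
  by rewrite mulnCA mulKn.
rewrite divn2.
rewrite [RHS](eq_bigr (fun j : 'I_d => wt q d i j * varphi z j.+1)); last first.
  by move=> j _; rewrite varphi_chi.
have sumE (G : nat -> R) : \sum_(j < d) G j = \sum_(j < d./2.*2.+1) G j.
  by rewrite -dE.
rewrite [RHS](sumE (fun j => wt q d i j * varphi z j.+1)).
rewrite (sum_pairs (fun j => wt q d i j * varphi z j.+1)).
have -> : wt q d i 0 = 1 :> R by rewrite /wt leqNgt (odd_gt0 od).
rewrite mul1r.
have wtE k : (1 <= k < d./2.+1)%N ->
  wt q d i (2 * k).-1 = (if (i < q)%N then 3 else 0) :> R /\
  wt q d i (2 * k) = (if (2 * q <= i)%N then 3 else 0) :> R.
  move=> /andP[k1 kd]; rewrite /wt.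
  have [-> ->] : odd (2 * k).-1 = true /\ odd (2 * k) = false by lia.
  have [-> ->] : (d <= (2 * k).-1)%N = false /\ (d <= 2 * k)%N = false by lia.
  have [-> ->] : ((2 * k).-1 == 0)%N = false /\ (2 * k == 0)%N = false by lia.
  by rewrite !andbT !andbF orbF.
case: ifPn => iq.
  congr (_ + _); rewrite mulr_sumr; apply: eq_big_nat => k kd.
  have [-> ->] := wtE k kd; rewrite iq ifF; last by apply/negbTE; lia.
  by rewrite mul0r addr0 prednK //; lia.
case: ifPn => iq2.
  rewrite -[LHS]addr0; congr (_ + _); rewrite big_nat_cond big1 // => k /andP[kd _].
  have [-> ->] := wtE k kd; rewrite (negbTE iq) ifF; last by apply/negbTE; lia.
  by rewrite !mul0r addr0.
congr (_ + _); rewrite mulr_sumr; apply: eq_big_nat => k kd.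
have [-> ->] := wtE k kd; rewrite (negbTE iq) ifT; last by lia.
by rewrite mul0r add0r.
Qed.

End ChainFunction.

(** * Gradient of the chain function *)

Section ChainPotential.
Context {R : realType}.
Variables (m d : nat) (C s : R) (w : nat -> nat -> R).
Hypotheses (C_ge0 : 0 <= C) (s_ge0 : 0 <= s).
Hypotheses (w_ge0 : forall i j, 0 <= w i j) (w_le3 : forall i j, w i j <= 3).
Hypothesis w_out : forall i j, (d <= j)%N -> w i j = 0.
Implicit Types x y : 'cV[R]_(m * d).

(* The scaled block i, with the constant 1 prepended. *)
Definition chain x (i j : nat) : R := if j is j'.+1 then s * ent x i j' else 1.

Definition chain_potential x : R :=
  C * \sum_(i < m) \sum_(j < d) w i j * chi (chain x i j) (chain x i j.+1).

(** Entry j of a block is the second argument of link j and the first of link j + 1, hence two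
    terms. Weights [v] and values [z] are separate arguments so that the weights of one block can be
    combined with the values of another. *)
Definition chain_partial (v z : nat -> R) (j : nat) : R :=
  C * s * (v j * chib (z j) (z j.+1) + v j.+1 * chia (z j.+1) (z j.+2)).

Definition dchain (h : 'cV[R]_(m * d)) (i j : nat) : R :=
  if j is j'.+1 then s * ent h i j' else 0.

Lemma is_diff_chain x i j :
  is_diff x (fun y => chain y i j) (fun h => dchain h i j).
Proof.
case: j => [|j]; first exact: is_diff_cst.
by have dE := is_diff_ent x i j; exact: is_diffZ.
Qed.

Lemma is_diff_of_derive (V : normedModType R) (f : R -> R) (p dp : V -> R)
    (a : V) (df : R) :
  is_derive (p a) 1 f df -> is_diff a p dp ->
  is_diff a (fun b => f (p b)) (fun h => df * dp h).
Proof.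
move=> [fd fdE] pd.
have fdiff : is_diff (p a) (f : R -> R^o) (fun h => df * h).
  split; first exact/derivable1_diffP.
  rewrite deriv1E // derive1E fdE; apply/funext => h.
  by rewrite /GRing.scale /= mulrC.
exact: (@is_diff_comp _ _ _ _ p dp f (fun h => df * h)).
Qed.

Lemma is_diff_chi (V : normedModType R) (p dp r dr : V -> R) (a : V) :
  is_diff a p dp -> is_diff a r dr ->
  is_diff a (fun b => chi (p b) (r b))
    (fun h => chia (p a) (r a) * dp h + chib (p a) (r a) * dr h).
Proof.
move=> dpx drx.
have dpN : is_diff a (fun b => - p b) (fun h => - dp h) by exact: is_diffN.
have drN : is_diff a (fun b => - r b) (fun h => - dr h) by exact: is_diffN.
have d1 := is_diff_of_derive (is_derive_Psi _) dpN.
have d2 := is_diff_of_derive (is_derive_Psi _) dpx.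
have d3 := is_diff_of_derive (is_derive_Phi _) drN.
have d4 := is_diff_of_derive (is_derive_Phi _) drx.
have d5 := is_diffB (is_diffM d1 d3) (is_diffM d2 d4).
apply: is_diff_eq d5 _; apply/funext => h.
rewrite /= !fctE /chia /chib dPhiN /GRing.scale /=; ring.
Qed.

Lemma is_diff_chi_chain x i j :
  is_diff x (fun y => chi (chain y i j) (chain y i j.+1))
    (fun h => chia (chain x i j) (chain x i j.+1) * dchain h i j
            + chib (chain x i j) (chain x i j.+1) * dchain h i j.+1).
Proof. by apply: is_diff_chi; exact: is_diff_chain. Qed.

Lemma chain_potentialE : chain_potential =
  C \*: \sum_(i < m) \sum_(j < d)
    (w i j \*: (fun y => chi (chain y i j) (chain y i j.+1) : R^o)).
Proof.
apply/funext => x; rewrite /chain_potential /= fct_sumE /GRing.scale /=.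
by congr (_ * _); apply: eq_bigr => i _; rewrite fct_sumE.
Qed.

Lemma differentiable_chain_potential x : differentiable chain_potential x.
Proof.
rewrite chain_potentialE; apply: differentiableZ.
apply: differentiable_sum => i; apply: differentiable_sum => j.
apply: differentiableZ.
by case: (is_diff_chi_chain x i j).
Qed.

Lemma sum_pick (G : nat -> R) n (k : 'I_n) :
  \sum_(i < n) G i * (i == k :> nat)%:R = G k.
Proof.
rewrite (bigD1 k) //= eqxx mulr1 big1 ?addr0 // => i ik.
by rewrite (negbTE (_ : (i != k :> nat)%N)) ?mulr0.
Qed.

Lemma gradient_chain_potential x (i : 'I_m) (j : 'I_d) :
  ent (gradient chain_potential x) i j = chain_partial (w i) (chain x i) j.
Proof.
rewrite entE mxE; set v := delta_mx _ _.
pose t (a b : nat) := chia (chain x a b) (chain x a b.+1) * dchain v a b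
                    + chib (chain x a b) (chain x a b.+1) * dchain v a b.+1.
have dt a b : is_derive x v
    (fun y => chi (chain y a b) (chain y a b.+1) : R^o) (t a b).
  have [fd fdE] := is_diff_chi_chain x a b.
  by split; [exact: diff_derivable|rewrite deriveE // fdE].
have -> : 'D_v chain_potential x = C * \sum_(a < m) \sum_(b < d) w a b * t a b.
  rewrite chain_potentialE; apply: derive_val.
have -> : \sum_(a < m) \sum_(b < d) w a b * t a b =
  \sum_(a < m) (s * (w a j * chib (chain x a j) (chain x a j.+1)
     + w a j.+1 * chia (chain x a j.+1) (chain x a j.+2))) * (a == i :> nat)%:R.
  apply: eq_bigr => a _.
  under eq_bigr => b _ do rewrite mulrDr.
  rewrite big_split /= mulrDr mulrDl addrC; congr (_ + _).
    under eq_bigr => b _.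
      rewrite ent_delta -mulnb natrM.
      rewrite (_ : _ * _ = s * (w a b * chib (chain x a b) (chain x a b.+1))
        * (a == i :> nat)%:R * (b == j :> nat)%:R); last by ring.
      over.
    by rewrite (sum_pick (fun b => s * (w a b * chib (chain x a b) (chain x a b.+1))
        * (a == i :> nat)%:R)).
  (* Link d has weight 0 and chain entry 0 is constant: adding the former and dropping the latter
     reindexes the sum by the d entries of the block. *)
  have -> : \sum_(b < d) w a b * (chia (chain x a b) (chain x a b.+1) * dchain v a b)
    = \sum_(b < d.+1) w a b * (chia (chain x a b) (chain x a b.+1) * dchain v a b).
    by rewrite big_ord_recr /= w_out // mul0r addr0.
  rewrite big_ord_recl /= !mulr0 add0r.
  under eq_bigr => b _.
    rewrite /bump /= ent_delta -mulnb natrM.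
    rewrite (_ : _ * _ = s * (w a b.+1 * chia (chain x a b.+1) (chain x a b.+2))
        * (a == i :> nat)%:R * (b == j :> nat)%:R); last by rewrite add1n; ring.
    over.
  by rewrite (sum_pick (fun b => s * (w a b.+1 * chia (chain x a b.+1) (chain x a b.+2))
        * (a == i :> nat)%:R)).
rewrite (sum_pick (fun a => s * (w a j * chib (chain x a j) (chain x a j.+1)
     + w a j.+1 * chia (chain x a j.+1) (chain x a j.+2)))).
by rewrite /chain_partial mulrA.
Qed.

(** Weights at most 3, and partial derivatives of a link at most 4 and 4 pi in absolute value. *)
Lemma chain_partial_bound v z j :
  (forall k, 0 <= v k <= 3) -> `|chain_partial v z j| <= C * s * (12 + 12 * pi).
Proof.
move=> vb; rewrite normrM ger0_norm ?mulr_ge0 // ler_wpM2l ?mulr_ge0 //.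
have := chib_bounds (z j) (z j.+1); have := chia_le0 (z j.+1) (z j.+2).
have := chia_ge (z j.+1) (z j.+2); have := vb j; have := vb j.+1.
have := @pi_gt0 R.
by rewrite ler_norml => *; apply/andP; split; nra.
Qed.

Lemma chain_partial_lipschitz v z z' j : (forall k, 0 <= v k <= 3) ->
  `|chain_partial v z j - chain_partial v z' j| <=
  C * s * (12 * `|z j - z' j| + (12 + 24 * pi) * `|z j.+1 - z' j.+1|
           + 12 * `|z j.+2 - z' j.+2|).
Proof.
move=> vb; rewrite /chain_partial -mulrBr normrM ger0_norm ?mulr_ge0 //.
rewrite ler_wpM2l ?mulr_ge0 //.
rewrite (_ : _ - _ = v j * (chib (z j) (z j.+1) - chib (z' j) (z' j.+1))
  + v j.+1 * (chia (z j.+1) (z j.+2) - chia (z' j.+1) (z' j.+2))); last by ring.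
have := chib_lipschitz (z j) (z j.+1) (z' j) (z' j.+1).
have := chia_lipschitz (z j.+1) (z j.+2) (z' j.+1) (z' j.+2).
have := vb j; have := vb j.+1.
move=> /andP[v1 v1'] /andP[v0 v0'] H1 H2; apply: le_trans (ler_normD _ _) _.
rewrite !normrM (ger0_norm v0) (ger0_norm v1).
have A : v j * `|chib (z j) (z j.+1) - chib (z' j) (z' j.+1)| <=
   3 * (4 * `|z j - z' j| + 4 * `|z j.+1 - z' j.+1|) by rewrite ler_pM.
have B : v j.+1 * `|chia (z j.+1) (z j.+2) - chia (z' j.+1) (z' j.+2)| <=
   3 * (8 * pi * `|z j.+1 - z' j.+1| + 4 * `|z j.+2 - z' j.+2|) by rewrite ler_pM.
by apply: le_trans (lerD A B) _; lra.
Qed.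

(** Each partial derivative depends on three consecutive chain entries, with constants 12, 12 + 24
    pi, 12. Cauchy-Schwarz with these as weights, followed by summation over j, produces their sum
    36 + 24 pi, independently of the length of the chain. *)
Lemma gradient_chain_lipschitz x y :
  enorm (gradient chain_potential x - gradient chain_potential y)
  <= C * s ^+ 2 * (36 + 24 * pi) * enorm (x - y).
Proof.
have p0 := @pi_gt0 R.
rewrite -(@ler_pXn2r _ 2) ?nnegrE ?mulr_ge0 ?enorm_ge0 ?sqr_ge0 ?addr_ge0 //; last by lra.
rewrite exprMn !sqr_enorm mulr_sumr; apply: ler_sum => i _.
pose e (j : nat) := `|dchain (x - y) i j|.
have eE j : e j.+1 ^+ 2 = s ^+ 2 * ent (x - y) i j ^+ 2.
  by rewrite /e /= real_normK ?num_real // exprMn.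
pose S := \sum_(j < d) ent (x - y) i j ^+ 2.
have S1 : \sum_(j < d) e j.+1 ^+ 2 = s ^+ 2 * S.
  by rewrite mulr_sumr; apply: eq_bigr => j _; rewrite eE.
have S0 : \sum_(j < d) e j ^+ 2 <= s ^+ 2 * S.
  rewrite -S1 -[leRHS]add0r -[X in X + _](_ : e 0%N ^+ 2 = 0); last first.
    by rewrite /e normr0 expr0n.
  rewrite -(big_ord_recl d (fun j : 'I_d.+1 => e j ^+ 2)) big_ord_recr /=.
  by rewrite lerDl sqr_ge0.
have S2 : \sum_(j < d) e j.+2 ^+ 2 <= s ^+ 2 * S.
  rewrite -S1 -[leRHS]addr0 -[X in _ + X](_ : e d.+1 ^+ 2 = 0); last first.
    by rewrite eE ent_out // expr0n mulr0.
  rewrite -(big_ord_recr d (fun j : 'I_d.+1 => e j.+1 ^+ 2)) big_ord_recl /=.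
  by rewrite lerDr sqr_ge0.
have bnd (j : 'I_d) : ent (gradient chain_potential x - gradient chain_potential y) i j ^+ 2
   <= (C * s) ^+ 2 * ((36 + 24 * pi) * (12 * e j ^+ 2 + (12 + 24 * pi) * e j.+1 ^+ 2
        + 12 * e j.+2 ^+ 2)).
  rewrite entB !gradient_chain_potential.
  have wb k : 0 <= w i k <= 3 by rewrite w_ge0 w_le3.
  have := chain_partial_lipschitz (chain x i) (chain y i) j wb.
  have eB k : `|chain x i k - chain y i k| = e k.
    by case: k => [|k]; rewrite /e /= ?subrr // entB mulrBr.
  rewrite !eB => H; rewrite -real_normK ?num_real //.
  have e0 k : 0 <= e k by exact: normr_ge0.
  apply: le_trans (_ : (C * s * (12 * e j + (12 + 24 * pi) * e j.+1 + 12 * e j.+2)) ^+ 2 <= _).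
    rewrite ler_pXn2r // nnegrE; apply: mulr_ge0; first exact: mulr_ge0.
    by have := e0 j; have := e0 j.+1; have := e0 j.+2; nra.
  rewrite [leLHS]exprMn ler_wpM2l ?sqr_ge0 //.
  move: (e j) (e j.+1) (e j.+2) => a b c.
  have := sqr_ge0 (a - b); have := sqr_ge0 (a - c); have := sqr_ge0 (b - c).
  move: p0; move: (pi : R) => P p0 h1 h2 h3.
  (* Lagrange's identity for weighted Cauchy-Schwarz: the defect is the sum of c_k c_l (e_k - e_l)^2
     over pairs. *)
  rewrite -subr_ge0 (_ : _ - _ = 144 * (a - c) ^+ 2 + 12 * (12 + 24 * P) * (a - b) ^+ 2
    + 12 * (12 + 24 * P) * (b - c) ^+ 2); last by ring.
  have hP : 0 <= 12 * (12 + 24 * P) by lra.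
  by have := mulr_ge0 hP h1; have := mulr_ge0 hP h3; lra.
apply: le_trans (ler_sum _ (fun j _ => bnd j)) _.
rewrite -!mulr_sumr !big_split /= -!mulr_sumr S1.
rewrite -/S.
have Cs : 0 <= (C * s) ^+ 2 by exact: sqr_ge0.
rewrite (_ : (C * s ^+ 2 * _) ^+ 2 * S = (C * s) ^+ 2 * ((36 + 24 * pi) *
  (12 * (s ^+ 2 * S) + (12 + 24 * pi) * (s ^+ 2 * S) + 12 * (s ^+ 2 * S)))); last by ring.
rewrite ler_wpM2l // ler_pM2l; last by lra.
by apply: lerD; [apply: lerD => //|]; rewrite ler_pM2l.
Qed.

Lemma chain_potential_ge (W : R) x :
  \sum_(i < m) \sum_(j < d) w i j = W -> - (4 * pi * C * W) <= chain_potential x.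
Proof.
move=> <-; rewrite (_ : - _ = C * (\sum_(i < m) \sum_(j < d) w i j * - (4 * pi))).
  rewrite ler_wpM2l //; apply: ler_sum => i _; apply: ler_sum => j _.
  by rewrite ler_wpM2l // chi_ge.
rewrite (_ : - _ = C * ((\sum_(i < m) \sum_(j < d) w i j) * - (4 * pi))); last by ring.
by rewrite mulr_suml; congr (_ * _); apply: eq_bigr => i _; rewrite mulr_suml.
Qed.

Lemma chain_potential0_le0 : chain_potential 0 <= 0.
Proof.
rewrite mulr_ge0_le0 //; apply: sumr_le0 => i _; apply: sumr_le0 => j _.
rewrite mulr_ge0_le0 // /chain ent0 mulr0; case: (nat_of_ord j) => [|k].
  rewrite /chi Psi_le0 ?oppr_le0 // mul0r sub0r oppr_le0 mulr_ge0 ?Psi_ge0 //.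
  by case/andP: (@Phi_bounds R 0).
by rewrite ent0 mulr0 chi0.
Qed.

End ChainPotential.

(** * Euclidean and l1 estimates, difference matrices *)

Section ColumnVectors.
Context {R : realType}.

Lemma entry_le_enorm k (z : 'cV[R]_k) i : `|z i 0| <= enorm z.
Proof.
rewrite -(@ler_pXn2r _ 2) ?nnegrE ?enorm_ge0 // sqr_enorm_dot.
by rewrite real_normK ?num_real // (bigD1 i) //= lerDl sumr_ge0 // => j _; exact: sqr_ge0.
Qed.

(** The crude factor [k.+1] stays positive for k = 0, so it can be divided by when choosing a
    radius. *)
Lemma enorm_le_entries k (z : 'cV[R]_k) (e : R) :
  (forall i, `|z i 0| <= e) -> 0 <= e -> enorm z <= k.+1%:R * e.
Proof.
move=> ze e0.
rewrite -(@ler_pXn2r _ 2) ?nnegrE ?enorm_ge0 ?mulr_ge0 // sqr_enorm_dot.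
apply: (@le_trans _ _ (\sum_(i < k) e ^+ 2)).
  apply: ler_sum => i _; rewrite -(real_normK (num_real (z i 0))).
  by rewrite ler_pXn2r ?nnegrE.
rewrite sumr_const card_ord -(mulr_natl (e ^+ 2)) exprMn ler_wpM2r ?sqr_ge0 //.
by rewrite -natrX ler_nat; nia.
Qed.

Lemma continuous_enorm_lipschitz k l (G : 'cV[R]_k -> 'cV[R]_l) (L : R) :
  (forall x y, enorm (G x - G y) <= L * enorm (x - y)) -> continuous G.
Proof.
move=> GL x.
have L0 : 0 < `|L| + 1 by rewrite ltr_pwDr.
move=> /= A /nbhs_ballP[e /= e0 eA].
have K0 : 0 < (`|L| + 1) * k.+1%:R * 2 by rewrite !mulr_gt0.
have d0 : 0 < e / ((`|L| + 1) * k.+1%:R * 2) by rewrite divr_gt0.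
apply/nbhs_ballP; exists (e / ((`|L| + 1) * k.+1%:R * 2)) => //= y [_ xy].
apply: eA; split=> // i j; rewrite (ord1 j) /ball /=.
rewrite -[_ - _](_ : (G x - G y) i 0 = _); last by rewrite !mxE.
apply: le_lt_trans (entry_le_enorm _ _) _; apply: le_lt_trans (GL x y) _.
have H : enorm (x - y) <= k.+1%:R * (e / ((`|L| + 1) * k.+1%:R * 2)).
  apply: enorm_le_entries (ltW d0) => a.
  by have := xy a 0; rewrite /ball /= !mxE => /ltW.
apply: (@le_lt_trans _ _ ((`|L| + 1) * enorm (x - y))).
  by rewrite ler_wpM2r ?enorm_ge0 //; have := ler_norm L; lra.
apply: (@le_lt_trans _ _ (e / 2)); last by lra.
move: H; rewrite -(ler_pM2l L0) => /le_trans; apply.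
rewrite le_eqVlt; apply/orP; left; apply/eqP; field.
by rewrite (gt_eqF L0) nat1r pnatr_eq0.
Qed.

Lemma gradient_shift k (f : 'cV[R]_k -> R) (x0 x : 'cV[R]_k) :
  gradient (fun y => f (y - x0)) x = gradient f (x - x0).
Proof.
apply/colP => i; rewrite !mxE /derive.
rewrite (_ : (fun y => f (y - x0)) \o shift x = f \o shift (x - x0)) //.
by apply/funext => h; rewrite /= addrA.
Qed.

Lemma l1normD k (y z : 'cV[R]_k) : l1norm (y + z) <= l1norm y + l1norm z.
Proof.
rewrite /l1norm -big_split; apply: ler_sum => i _ /=.
by rewrite mxE ler_normD.
Qed.

Lemma l1normZ k (a : R) (z : 'cV[R]_k) : l1norm (a *: z) = `|a| * l1norm z.
Proof.
by rewrite /l1norm mulr_sumr; apply: eq_bigr => i _; rewrite mxE normrM.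
Qed.

Lemma continuous_mulmx_entry k l (M : 'M[R]_(k, l)) i :
  continuous (fun y : 'cV[R]_l => (M *m y) i 0).
Proof.
have -> : (fun y : 'cV[R]_l => (M *m y) i 0) = (fun y => \sum_j M i j * y j 0).
  by apply/funext => y; rewrite mxE.
have cj j (_ : true) : continuous (fun y : 'cV[R]_l => M i j * y j 0).
  move=> y; exact: (cvgM (cvg_cst _) (@coord_continuous R l 1 j 0 y)).
exact: (continuous_big (@add_continuous R) cj).
Qed.

Lemma proper_lsc_convex_l1 k l (c : R) (M : 'M[R]_(k, l)) (v : 'cV[R]_k) :
  0 <= c -> proper_lsc_convex (fun x => (c * l1norm (M *m x + v))%:E).
Proof.
move=> c0; split.
- by split=> [x|]; [exact: ltNyr|exists 0; exact: ltry].
- have cf : continuous (fun x => c * l1norm (M *m x + v)).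
    have -> : (fun x => c * l1norm (M *m x + v)) =
       (fun x => c * \sum_i `|(M *m x) i 0 + v i 0|).
      by apply/funext => x; congr (_ * _); apply: eq_bigr => i _; rewrite !mxE.
    suff cs : continuous (fun x : 'cV[R]_l => \sum_i `|(M *m x) i 0 + v i 0|).
      by move=> x; exact: (cvgM (cvg_cst _) (cs x)).
    have ci i (_ : true) : continuous (fun x : 'cV[R]_l => `|(M *m x) i 0 + v i 0|).
      move=> y.
      have cM : (M *m x) i 0 @[x --> y] --> (M *m y) i 0.
        exact: continuous_mulmx_entry.
      exact: (cvg_norm (cvgD cM (cvg_cst _))).
    exact: (continuous_big (@add_continuous R) ci).
  move=> x a; rewrite lte_fin => ax.
  exists [set y | a < c * l1norm (M *m y + v)]; last by move=> y; rewrite lte_fin.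
  exact: cvgr_gt (cf x) _ ax.
- move=> x y t /andP[/ltW t0 /ltW t1].
  rewrite -!EFinM -EFinD lee_fin.
  have -> : M *m (t *: x + (1 - t) *: y) + v = t *: (M *m x + v) + (1 - t) *: (M *m y + v).
    rewrite mulmxDr -!scalemxAr !scalerDr [in RHS]addrACA -scalerDl.
    by rewrite addrCA addrN addr0 scale1r.
  rewrite mulrCA [X in _ <= _ + X]mulrCA -mulrDr ler_wpM2l //.
  apply: le_trans (l1normD _ _) _; rewrite !l1normZ !ger0_norm //.
  by rewrite subr_ge0.
Qed.

Lemma spectral_norm_ge0 k l (M : 'M[R]_(k, l)) : 0 <= spectral_norm M.
Proof.
rewrite /spectral_norm; set S := image _ _.
have [hS|/sup_out->] := pselect (has_sup S); last by [].
apply: (ub_le_sup hS.2).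
exists 0; last by rewrite mulmx0 /enorm big1 ?sqrtr0 // => i _; rewrite mxE expr0n.
by rewrite /= /enorm big1 ?sqrtr0 // => i _; rewrite mxE expr0n.
Qed.

Lemma eps_stationary_recenter d n nbar (eps : R) (P : problem R d n nbar) x0 x :
  eps_stationary eps (recenter x0 P) x -> eps_stationary eps P (x - x0).
Proof.
move=> [gamma H]; exists gamma; move: H; rewrite /recenter /=.
rewrite gradient_shift (_ : A_ P *m x + _ = A_ P *m (x - x0) + b_ P); last first.
  by rewrite mulmxBr -!addrA; congr (_ + _); rewrite addrC.
suff -> : subdiff (fun y => g_ P (y - x0)) x = subdiff (g_ P) (x - x0) by [].
apply/seteqP; split=> v /= H y.
  by have := H (y + x0); rewrite addrK opprB addrA.
have := H (y - x0).
by rewrite (_ : y - x0 - (x - x0) = y - x) // opprB addrA subrK.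
Qed.

End ColumnVectors.

Section DifferenceRows.
Context {R : realType}.
Variables m d : nat.

(** Rows are labelled from 1 and blocks from 0, so row s is the edge between blocks [s.-1] and
    [s]. *)
Lemma ent_Jrows (c : R) (l : seq nat) k (x : 'cV[R]_(m * d)) (r : 'I_k) (j : 'I_d) :
  {in l, forall s, (0 < s < m)%N} -> size l = k ->
  ent (((c *: tensmx (Jrows m l k) 1%:M) : 'M[R]_(k * d, m * d)) *m x) r j
  = c * (ent x (nth 0%N l r) j - ent x (nth 0%N l r).-1 j).
Proof.
move=> lm szl; set s := nth _ _ _.
have /andP[s0 sm] : (0 < s < m)%N by apply: lm; rewrite mem_nth // szl.
rewrite -scalemxAl entZ; congr (_ * _); rewrite entE mxE sum_mxtens.
have -> : \sum_(i < m) \sum_(a < d) (tensmx (Jrows m l k) 1%:M : 'M[R]_(k * d, m * d))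
     (mxtens_index (r, j)) (mxtens_index (i, a)) * x (mxtens_index (i, a)) 0
  = \sum_(i < m) (ent x i j * (i == Ordinal sm :> nat)%:R
      - ent x i j * (i == Ordinal (leq_ltn_trans (leq_pred s) sm) :> nat)%:R).
  apply: eq_bigr => i _; rewrite (bigD1 j) //= big1 ?addr0 => [|a aj]; last first.
    by rewrite tensmxE [1%:M _ _]mxE eq_sym (negbTE aj) mulr0 mul0r.
  rewrite tensmxE [1%:M _ _]mxE eqxx mulr1 mxE -/s -entE eqSS.
  have -> : (i.+1 == s) = (i == s.-1 :> nat) by rewrite -(prednK s0).
  case: eqP => [->|_]; last by case: eqP => _; rewrite ?mulr1 ?mulr0 ?subr0 ?mul1r ?mul0r.
  rewrite (_ : (s.-1 == s) = false); last by apply/negbTE; rewrite -(prednK s0); lia.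
  by rewrite mulr0 mulr1 sub0r mulN1r.
rewrite sumrB (sum_pick (fun i => ent x i j) (Ordinal sm)).
by rewrite (sum_pick (fun i => ent x i j) (Ordinal (leq_ltn_trans (leq_pred s) sm))).
Qed.

Lemma sum_nth_ord (F : nat -> R) (l : seq nat) k :
  size l = k -> \sum_(r < k) F (nth 0%N l r) = \sum_(s <- l) F s.
Proof. by move=> <-; rewrite (big_nth 0%N) big_mkord. Qed.

Lemma sqr_enorm_Jrows (c : R) (l : seq nat) k (x : 'cV[R]_(m * d)) :
  {in l, forall s, (0 < s < m)%N} -> size l = k ->
  enorm (((c *: tensmx (Jrows m l k) 1%:M) : 'M[R]_(k * d, m * d)) *m x) ^+ 2
  = c ^+ 2 * \sum_(s <- l) \sum_(j < d) (ent x s j - ent x s.-1 j) ^+ 2.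
Proof.
move=> lm szl; rewrite sqr_enorm mulr_sumr -(sum_nth_ord _ szl).
apply: eq_bigr => r _; rewrite mulr_sumr; apply: eq_bigr => j _.
by rewrite ent_Jrows // exprMn.
Qed.

Lemma l1norm_Jrows (c : R) (l : seq nat) k (x : 'cV[R]_(m * d)) : 0 <= c ->
  {in l, forall s, (0 < s < m)%N} -> size l = k ->
  l1norm (((c *: tensmx (Jrows m l k) 1%:M) : 'M[R]_(k * d, m * d)) *m x)
  = c * \sum_(s <- l) \sum_(j < d) `|ent x s j - ent x s.-1 j|.
Proof.
move=> c0 lm szl; rewrite /l1norm sum_mxtens mulr_sumr -(sum_nth_ord _ szl).
apply: eq_bigr => r _; rewrite mulr_sumr; apply: eq_bigr => j _.
by rewrite -entE ent_Jrows // normrM ger0_norm.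
Qed.

End DifferenceRows.

(** * Condition number *)

Section EdgeSets.
Variables m1 m2 : nat.
Hypotheses (m1_gt1 : (1 < m1)%N) (m2_gt0 : (0 < m2)%N).
Local Notation m := (nblocks m1 m2).

Lemma calM_range : {in calM m1 m2, forall s, (0 < s < m)%N}.
Proof.
move=> s /mapP[i]; rewrite mem_iota /nblocks => ih ->.
by rewrite muln_gt0 (ltnW m1_gt1) andbT; nia.
Qed.

Lemma calMC_range : {in calMC m1 m2, forall s, (0 < s < m)%N}.
Proof. by move=> s; rewrite mem_filter mem_iota => /andP[_ /andP[s0 sm]]; lia. Qed.

Lemma calM_nonconsecutive s : s \in calM m1 m2 -> s.+1 \in calM m1 m2 -> False.
Proof.
move=> /mapP[i _ ->] /mapP[k _ E].
have : (i * m1 < k * m1)%N by rewrite -E.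
rewrite ltn_pmul2r ?(ltnW m1_gt1) // => ik.
have : (i.+1 * m1 <= k * m1)%N by rewrite leq_pmul2r ?(ltnW m1_gt1).
by rewrite -E mulSn => h; lia.
Qed.

(** Consequently the stacked matrix is, up to the order of its rows, m Lf J_m tensored with the
    identity: the difference operator of a whole path. *)
Lemma calM_cat_calMC : perm_eq (calM m1 m2 ++ calMC m1 m2) (index_iota 1 m).
Proof.
have uM : uniq (calM m1 m2).
  rewrite map_inj_uniq ?iota_uniq // => i k /eqP.
  by rewrite eqn_pmul2r ?(ltnW m1_gt1) // => /eqP.
rewrite /index_iota perm_sym -(perm_filterC (mem (calM m1 m2)) _) perm_cat //.
apply: uniq_perm; rewrite ?filter_uniq ?iota_uniq // => s.
rewrite mem_filter /= mem_iota; case sM : (s \in _) => //=.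
by have := calM_range sM; lia.
Qed.

Lemma size_calM : size (calM m1 m2) = (3 * m2 - 1)%N.
Proof. by rewrite size_map size_iota. Qed.

Lemma size_calMC : size (calMC m1 m2) = (m - 3 * m2)%N.
Proof.
have := perm_size calM_cat_calMC.
rewrite size_cat size_calM size_iota.
by move: (size (calMC m1 m2)) => /= k; lia.
Qed.

End EdgeSets.

(** * Discrete Poincare inequality on a path *)

Section DiscretePoincare.
Context {R : realType}.
Implicit Types (a : nat -> R) (m i : nat).

Lemma sqr_diff_le_path a p k :
  (a (p + k)%N - a p) ^+ 2 <=
  k%:R * \sum_(p.+1 <= s < (p + k).+1) (a s - a s.-1) ^+ 2.
Proof.
elim: k => [|k IH]; first by rewrite addn0 subrr expr0n mul0r.
rewrite addnS big_nat_recr //=; last by lia.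
move: IH; set S := \sum_(_ <= _ < _) _; set X := a (p + k)%N - a p.
set D := _ - a (p + k)%N => IH.
have -> : a (p + k).+1 - a p = X + D by rewrite /X /D; ring.
case: k @X @D @S IH => [|k] X D S IH.
  have S0 : S = 0 by rewrite /S addn0 big_geq.
  by rewrite S0 /X addn0 subrr !add0r mul1r.
have k0 : (0 : R) < k.+1%:R by rewrite ltr0n.
rewrite -[k.+2]addn1 natrD.
move: IH k0; move: (k.+1%:R : R) S X D => n S X D IH n0.
(* Inductive form of Cauchy-Schwarz: 2 X (n D) <= X^2 + (n D)^2, with X^2 <= n S by induction,
   divided by n. *)
have h : 2 * X * D <= S + n * D ^+ 2.
  rewrite -(ler_pM2l n0); have := sqr_ge0 (X - n * D); nra.
nra.
Qed.

Lemma sqr_diff_le a m i k : (i < m)%N -> (k < m)%N ->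
  (a i - a k) ^+ 2 <= m%:R * \sum_(1 <= s < m) (a s - a s.-1) ^+ 2.
Proof.
wlog ki : i k / (k <= i)%N => [H im km|im km].
  have [ki|/ltnW ik] := leqP k i; first exact: H.
  by rewrite -sqrrN opprB; exact: H.
have := sqr_diff_le_path a k (i - k); rewrite subnKC // => /le_trans; apply.
apply: ler_pM => //; first by rewrite sumr_ge0 // => s _; exact: sqr_ge0.
  by rewrite ler_nat; lia.
rewrite [leRHS](@big_cat_nat _ _ _ k.+1) //=.
rewrite [X in _ <= _ + X](@big_cat_nat _ _ _ i.+1) //=.
rewrite addrCA lerDl addr_ge0 // sumr_ge0 // => s _; exact: sqr_ge0.
Qed.

(** Subtracting a constant from a mean-zero sequence can only increase its sum of squares; with the
    constant [a 0] every term is a difference along a path. *)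
Lemma poincare a m : \sum_(i < m) a i = 0 ->
  \sum_(i < m) a i ^+ 2 <= m%:R ^+ 2 * \sum_(1 <= s < m) (a s - a s.-1) ^+ 2.
Proof.
case: m => [|m] a0; first by rewrite big_ord0 expr0n mul0r.
apply: (@le_trans _ _ (\sum_(i < m.+1) (a i - a 0%N) ^+ 2)).
  have -> : \sum_(i < m.+1) (a i - a 0%N) ^+ 2 = \sum_(i < m.+1) a i ^+ 2
     - 2 * a 0%N * (\sum_(i < m.+1) a i) + \sum_(i < m.+1) a 0%N ^+ 2.
    rewrite mulr_sumr -sumrB -big_split /=.
    by apply: eq_bigr => i _; ring.
  by rewrite a0 mulr0 subr0 lerDl sumr_ge0 // => i _; exact: sqr_ge0.
apply: (@le_trans _ _
    (\sum_(i < m.+1) m.+1%:R * \sum_(1 <= s < m.+1) (a s - a s.-1) ^+ 2)).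
  by apply: ler_sum => i _; exact: sqr_diff_le.
by rewrite sumr_const card_ord -[leLHS]mulr_natl mulrA expr2.
Qed.

Lemma sum_sqr_diff_le a m :
  \sum_(1 <= s < m) (a s - a s.-1) ^+ 2 <= 4 * \sum_(i < m) a i ^+ 2.
Proof.
case: m => [|m]; first by rewrite big_geq // big_ord0 mulr0.
rewrite big_add1 /= big_mkord.
apply: (@le_trans _ _ (\sum_(i < m) (2 * a i.+1 ^+ 2 + 2 * a i ^+ 2))).
  by apply: ler_sum => i _; have := sqr_ge0 (a i.+1 + a i); nra.
rewrite big_split /= -!mulr_sumr.
have h1 : \sum_(i < m) a i.+1 ^+ 2 <= \sum_(i < m.+1) a i ^+ 2.
  by rewrite big_ord_recl /= lerDr sqr_ge0.
have h2 : \sum_(i < m) a i ^+ 2 <= \sum_(i < m.+1) a i ^+ 2.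
  by rewrite big_ord_recr /= lerDl sqr_ge0.
lra.
Qed.

End DiscretePoincare.

Section ConditionNumber.
Context {R : realType}.

(** If v is an eigenvector of M M^T for a > 0, then u = M^T v is orthogonal to the kernel of M and
    |M u|^2 = a |u|^2, so the two estimates at u enclose a. *)
Lemma kappa_le k l (M : 'M[R]_(k, l)) (c1 c2 : R) : 0 < c1 -> 0 <= c2 ->
  (forall x : 'cV[R]_l, enorm (M *m x) ^+ 2 <= c2 * enorm x ^+ 2) ->
  (forall x : 'cV[R]_l, (forall e : 'cV[R]_l, M *m e = 0 -> dotv x e = 0) ->
    c1 * enorm x ^+ 2 <= enorm (M *m x) ^+ 2) ->
  kappa M <= Num.sqrt (c2 / c1).
Proof.
move=> c10 c20 Mle Mge.
pose S := M *m M^T.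
have enE n (z : 'cV[R]_n) : enorm z ^+ 2 = (z^T *m z) 0 0.
  by rewrite sqr_enorm_dot mxE; apply: eq_bigr => i _; rewrite mxE expr2.
have bounds a : eigenvalue S a -> 0 < a -> c1 <= a <= c2.
  move=> /eigenvalueP[v vS v0] a0.
  pose u := M^T *m v^T.
  have Mu : M *m u = a *: v^T.
    rewrite /u mulmxA -[M *m M^T]trmxK trmx_mul trmxK -trmx_mul vS.
    by rewrite linearZ.
  have u2 : enorm u ^+ 2 = a * enorm v^T ^+ 2.
    by rewrite !enE trmx_mul !trmxK -mulmxA Mu -scalemxAr mxE.
  have Mu2 : enorm (M *m u) ^+ 2 = a * enorm u ^+ 2.
    rewrite u2 Mu !sqr_enorm_dot !mulr_sumr; apply: eq_bigr => i _.
    by rewrite mxE; ring.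
  have vp : 0 < enorm v^T ^+ 2.
    rewrite lt_neqAle sqr_ge0 andbT eq_sym; apply: contra v0 => /eqP v0.
    apply/eqP/rowP => i; have := entry_le_enorm v^T i.
    move/eqP: v0; rewrite sqrf_eq0 => /eqP ->; rewrite normr_le0 => /eqP.
    by rewrite !mxE.
  have up : 0 < enorm u ^+ 2 by rewrite u2 mulr_gt0.
  have := Mle u; rewrite Mu2 ler_pM2r // => ->; rewrite andbT.
  rewrite -(ler_pM2r up) -Mu2; apply: Mge => e Me.
  transitivity ((u^T *m e) 0 0).
    by rewrite mxE; apply: eq_bigr => i _; rewrite [in RHS]mxE.
  by rewrite trmx_mul !trmxK -mulmxA Me mulmx0 mxE.
rewrite /kappa -/S ler_wsqrtr //.
have maxle : lambda_max S <= c2.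
  rewrite /lambda_max; set E := [set a | _].
  have [->|/set0P E0] := eqVneq E set0; first by rewrite sup0.
  apply: ge_sup => // a Ea; have [a0|a0] := leP a 0; first exact: le_trans c20.
  by have /andP[] := bounds a Ea a0.
rewrite /lambda_min_pos; set E := [set a | _ /\ _].
(* Without positive eigenvalues the infimum is 0 by default, and so is its inverse; the quotient is
   then 0. *)
have [->|/set0P E0] := eqVneq E set0.
  by rewrite inf0 invr0 mulr0 divr_ge0 // ltW.
have minge : c1 <= inf E.
  by apply: lb_le_inf => // a [Ea a0]; have /andP[] := bounds a Ea a0.
have iE0 : 0 < inf E by exact: lt_le_trans minge.
apply: (@le_trans _ _ (c2 / inf E)); first by rewrite ler_pM2r ?invr_gt0.
by rewrite ler_wpM2l // lef_pV2.
Qed.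

End ConditionNumber.

Section InstanceConditionNumber.
Context {R : realType}.
Variables (Lf : R) (m1 m2 d : nat).
Hypotheses (Lf_gt0 : 0 < Lf) (m1_gt1 : (1 < m1)%N) (m2_gt0 : (0 < m2)%N).
Local Notation m := (nblocks m1 m2).
Local Notation stacked := (col_mx (instAbar Lf m1 m2 d) (instA Lf m1 m2 d)).

Lemma nblocks_gt0 : (0 < m)%N.
Proof. by rewrite !muln_gt0 m2_gt0 (ltnW m1_gt1). Qed.

Definition edge_energy (x : 'cV[R]_(m * d)) : R :=
  \sum_(j < d) \sum_(1 <= s < m) (ent x s j - ent x s.-1 j) ^+ 2.

Lemma sqr_enorm_stacked (x : 'cV[R]_(m * d)) :
  enorm (instAbar Lf m1 m2 d *m x) ^+ 2 + enorm (instA Lf m1 m2 d *m x) ^+ 2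
  = (m%:R * Lf) ^+ 2 * edge_energy x.
Proof.
rewrite (sqr_enorm_Jrows _ _ (calM_range m1_gt1 m2_gt0) (size_calM _ _)).
rewrite (sqr_enorm_Jrows _ _ (calMC_range m1_gt1 m2_gt0) (size_calMC m1_gt1 m2_gt0)).
rewrite -mulrDr -big_cat (perm_big _ (calM_cat_calMC m1_gt1 m2_gt0)) /=.
by rewrite /edge_energy exchange_big.
Qed.

Lemma sqr_enorm_col_mx k l n (A : 'M[R]_(k, n)) (B : 'M[R]_(l, n)) (x : 'cV[R]_n) :
  enorm (col_mx A B *m x) ^+ 2 = enorm (A *m x) ^+ 2 + enorm (B *m x) ^+ 2.
Proof.
rewrite mul_col_mx !sqr_enorm_dot big_split_ord /=.
by congr (_ + _); apply: eq_bigr => i _; rewrite (col_mxEu, col_mxEd).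
Qed.

(** The kernel contains the vectors constant over blocks in one coordinate; orthogonality to them is
    the mean-zero condition of [poincare]. The estimates 4 (m Lf)^2 and Lf^2 have quotient
    (2m)^2. *)
Lemma kappa_instance : kappa stacked <= 2 * m%:R.
Proof.
have m0 : 0 < (m%:R : R) by rewrite ltr0n nblocks_gt0.
have mL : 0 < m%:R * Lf by rewrite mulr_gt0.
have -> : 2 * m%:R = Num.sqrt ((m%:R * Lf) ^+ 2 * 4 / Lf ^+ 2).
  have -> : (m%:R * Lf) ^+ 2 * 4 / Lf ^+ 2 = (2 * m%:R) ^+ 2.
    by field; rewrite gt_eqF.
  by rewrite sqrtr_sqr ger0_norm // mulr_ge0 // ltW.
apply: kappa_le.
- by rewrite exprn_gt0.
- by rewrite mulr_ge0 ?sqr_ge0.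
- move=> x; rewrite sqr_enorm_col_mx sqr_enorm_stacked -mulrA.
  rewrite ler_wpM2l ?sqr_ge0 // sqr_enorm exchange_big mulr_sumr /=.
  by apply: ler_sum => j _; exact: (sum_sqr_diff_le (fun i => ent x i j)).
- move=> x xker; rewrite sqr_enorm_col_mx sqr_enorm_stacked.
  rewrite exprMn (mulrC (m%:R ^+ 2)) -[leRHS]mulrA ler_pM2l ?exprn_gt0 //.
  rewrite sqr_enorm exchange_big /edge_energy mulr_sumr; apply: ler_sum => j _.
  apply: (@poincare R (fun i => ent x i j) m).
  pose e : 'cV[R]_(m * d) := \col_k ((mxtens_unindex k).2 == j)%:R.
  have entE' (i : 'I_m) (j' : 'I_d) : ent e i j' = (j' == j)%:R.
    by rewrite entE mxE mxtens_indexK.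
  have H : enorm (stacked *m e) ^+ 2 = 0.
    rewrite sqr_enorm_col_mx sqr_enorm_stacked /edge_energy.
    rewrite big1 ?mulr0 // => j' _; rewrite big_nat_cond big1 // => s.
    rewrite andbT => /andP[s0 sm].
    have sm' := leq_ltn_trans (leq_pred s) sm.
    by rewrite (entE' (Ordinal sm)) (entE' (Ordinal sm')) subrr expr0n.
  have Me : stacked *m e = 0.
    apply/colP => r; have := entry_le_enorm (stacked *m e) r.
    by move/eqP: H; rewrite sqrf_eq0 => /eqP ->; rewrite normr_le0 mxE [RHS]mxE => /eqP.
  rewrite -[RHS](xker e Me) dotv_ent; apply: eq_bigr => i _.
  rewrite (bigD1 j) //= entE' eqxx mulr1 big1 ?addr0 //.
  by move=> j' jj; rewrite entE' (negbTE jj) mulr0.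
Qed.

End InstanceConditionNumber.

(** * Propagation of the support *)

Section InstanceObjective.
Context {R : realType}.
Variables (eps Lf : R) (m1 m2 d : nat) (beta : R).
Hypotheses (eps_gt0 : 0 < eps) (Lf_gt0 : 0 < Lf) (m1_gt1 : (1 < m1)%N)
  (m2_gt0 : (0 < m2)%N) (d_odd : odd d).
Local Notation m := (nblocks m1 m2).
Local Notation q := (m1 * m2)%N.
Local Notation P := (instP eps Lf m1 m2 d beta).

Definition cst_out : R := 300 * pi * eps ^+ 2 / (m%:R * Lf).
Definition cst_in : R := Num.sqrt m%:R * Lf / (150 * pi * eps).

Lemma nblocksE : m = (3 * q)%N.
Proof. by rewrite /nblocks mulnA. Qed.

Lemma nblocks_gt0R : 0 < (m%:R : R).
Proof. by rewrite ltr0n nblocks_gt0. Qed.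

Lemma cst_out_gt0 : 0 < cst_out.
Proof.
by rewrite divr_gt0 ?mulr_gt0 ?exprn_gt0 ?pi_gt0 ?nblocks_gt0R.
Qed.

Lemma cst_in_gt0 : 0 < cst_in.
Proof.
by rewrite divr_gt0 ?mulr_gt0 ?pi_gt0 ?sqrtr_gt0 ?nblocks_gt0R.
Qed.

(** The scale of one partial derivative; over m blocks it adds up to 2 sqrt m * eps, twice what an
    eps-small gradient can have in one coordinate. *)
Lemma cst_out_in : cst_out * cst_in = 2 * eps / Num.sqrt m%:R.
Proof.
have sm : 0 < Num.sqrt m%:R :> R by rewrite sqrtr_gt0 nblocks_gt0R.
have smE : m%:R = Num.sqrt m%:R ^+ 2 :> R by rewrite sqr_sqrtr // ltW // nblocks_gt0R.
have p0 := pi_gt0 R.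
suff E (r p : R) : 0 < r -> 0 < p ->
    300 * p * eps ^+ 2 / (r ^+ 2 * Lf) * (r * Lf / (150 * p * eps)) = 2 * eps / r.
  by rewrite /cst_out /cst_in -(E _ _ sm p0) -smE.
by move=> r0 {}p0; field; rewrite !gt_eqF.
Qed.

Lemma cst_out_in2 : cst_out * cst_in ^+ 2 = Lf / (75 * pi).
Proof.
have sm : 0 < Num.sqrt m%:R :> R by rewrite sqrtr_gt0 nblocks_gt0R.
rewrite expr2 mulrA cst_out_in /cst_in.
move: (Num.sqrt _) (pi : R) sm (pi_gt0 R) => r p r0 p0.
by field; rewrite !gt_eqF.
Qed.

Local Notation potential := (chain_potential cst_out cst_in (wt q d)).

Lemma ext_chain (x : 'cV[R]_(m * d)) (i : 'I_m) j :
  ext (cst_in *: blk x i) j = chain cst_in x i j.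
Proof.
case: j => // j; rewrite /= /coord1 /ent valK /=.
by case: insubP => [a _ _|_]; rewrite ?mulr0 // !mxE.
Qed.

Lemma f0_instance : f0_ P = potential.
Proof.
apply/funext => x; rewrite /chain_potential mulr_sumr; apply: eq_bigr => i _.
rewrite /fi -/cst_out -/cst_in; congr (_ * _).
rewrite (_ : hfun m i.+1 _ = hfun (3 * q) i.+1 (cst_in *: blk x i)); last by rewrite -nblocksE.
by rewrite hfunE //; apply: eq_bigr => j _; rewrite !ext_chain.
Qed.

Definition jump_l1 (x : 'cV[R]_(m * d)) : R :=
  \sum_(s <- calM m1 m2) \sum_(j < d) `|ent x s j - ent x s.-1 j|.

Lemma g_instance x : g_ P x = (beta * jump_l1 x)%:E.
Proof.
rewrite /= /instgbar (l1norm_Jrows _ _ (calM_range m1_gt1 m2_gt0) (size_calM _ _)).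
  rewrite mulrA divfK // mulf_neq0 // gt_eqF //; exact: nblocks_gt0R.
by rewrite mulr_ge0 // ltW.
Qed.

Lemma gradient_instance x (i : 'I_m) (j : 'I_d) :
  ent (gradient (f0_ P) x) i j
  = chain_partial cst_out cst_in (wt q d i) (chain cst_in x i) j.
Proof.
rewrite f0_instance gradient_chain_potential // => a b db.
by rewrite /wt db.
Qed.

End InstanceObjective.

Section SupportPropagation.
Context {R : realType}.
Variables (eps Lf : R) (m1 m2 d : nat) (beta : R).
Hypotheses (eps_gt0 : 0 < eps) (Lf_gt0 : 0 < Lf) (m1_gt1 : (1 < m1)%N)
  (m2_gt0 : (0 < m2)%N) (d_odd : odd d) (beta_gt0 : 0 < beta).
Local Notation m := (nblocks m1 m2).
Local Notation q := (m1 * m2)%N.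
Local Notation P := (instP eps Lf m1 m2 d beta).
Implicit Types x y z : 'cV[R]_(m * d).

(* A lower bound on the distance of entry (i, j) (0-based) from the entries
   (i, 0), in a graph whose edges join (i, j) to (i.+1, j), and to (i, j.+1)
   when the chain weight of (i, j.+1) is nonzero: an even number of j steps
   crosses the middle third of the blocks each time. *)
Definition depth (i j : nat) : nat :=
  if j is 0%N then 0%N
  else if odd j then (j.-1 * q + (i.+1 - q))%N else (j.-1 * q + (2 * q - i))%N.

Definition reached (n : nat) x : Prop :=
  forall (i : 'I_m) (j : 'I_d), (n < depth i j)%N -> ent x i j = 0.

Lemma reachedW n k x : (n <= k)%N -> reached n x -> reached k x.
Proof. by move=> nk xn i j kd; apply: xn; exact: leq_ltn_trans kd. Qed.

Lemma depth_succ i j : (depth i.+1 j <= (depth i j).+1)%N.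
Proof. by case: j => // j; rewrite /depth /=; case: odd => /=; lia. Qed.

Lemma depth_pred i j : (depth i j <= (depth i.+1 j).+1)%N.
Proof. by case: j => // j; rewrite /depth /=; case: odd => /=; lia. Qed.

(** Where the link is active, the truncated difference in [depth i j.+1] is 0, while for j > 0 entry
    (i, j) has already paid at least q for the last crossing. *)
Lemma depth_coord i j : wt q d i j.+1 != 0 :> R -> (depth i j.+1 <= depth i j)%N.
Proof.
rewrite /wt /=; case: ifP => [_|_]; first by rewrite eqxx.
case: ifP => [c _|_]; last by rewrite eqxx.
move: c; rewrite /depth; case: j => [|j] /=.
  by rewrite andbT andbF orbF => iq; lia.
rewrite negbK; case: (odd j) => /= c; rewrite ?mulSn; lia.
Qed.

Lemma reached_span n (X : seq 'cV[R]_(m * d)) x :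
  x \in <<X>>%VS -> (forall y, y \in X -> reached n y) -> reached n x.
Proof.
move=> /(coord_span (X := in_tuple X)) -> HX i j ij.
have : forall (I : finType) (c : I -> R) (Y : I -> 'cV[R]_(m * d)),
    (forall k, ent (Y k) i j = 0) -> ent (\sum_k c k *: Y k) i j = 0.
  move=> I c Y HY; apply: (big_ind (fun z => ent z i j = 0)).
  - exact: ent0.
  - by move=> a b Ha Hb; rewrite entD Ha Hb addr0.
  - by move=> k _; rewrite entZ HY mulr0.
apply=> k; apply: HX ij; exact: mem_nth.
Qed.

(** By [chia0] and [chib0], entry j can be nonzero only if entry j of the block is, or entry j - 1
    is and the link between them is active. *)
Lemma reached_gradient n x : reached n x -> reached n.+1 (gradient (f0_ P) x).
Proof.
move=> xn i j dij.
have xij : ent x i j = 0 by apply: xn; exact: ltnW.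
rewrite gradient_instance // /chain_partial [chain _ x i j.+1]/= xij mulr0.
rewrite chia0 mulr0 addr0.
case: j dij {xij} => -[|j] jd /= dij; first by [].
have [->|wn0] := eqVneq (wt q d i j.+1 : R) 0; first by rewrite mul0r mulr0.
have jd' := ltnW jd.
have -> : ent x i j = 0.
  apply: (xn i (Ordinal jd')); have := depth_coord wn0.
  by move/(leq_trans dij); exact: ltnW.
by rewrite mulr0 chib0 !mulr0.
Qed.

(** Only edges at block i have a nonzero entry in the column concerned, and they see no blocks other
    than i - 1, i, i + 1. *)
Lemma reached_normal n x :
  reached n x -> reached n.+1 ((instA Lf m1 m2 d)^T *m (instA Lf m1 m2 d *m x)).
Proof.
move=> xn i j dij; rewrite entE.
set A := instA _ _ _ _; set k := mxtens_index _.
have -> : (A^T *m (A *m x)) k 0 = dotv (A *m delta_mx k 0) (A *m x).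
  rewrite mxE; apply: eq_bigr => r _; congr (_ * _).
  by rewrite -colE !mxE.
rewrite dotv_ent big1 // => r _; rewrite big1 // => b _.
have lM := calMC_range m1_gt1 m2_gt0; have lS := size_calMC m1_gt1 m2_gt0.
rewrite !ent_Jrows //; set s := nth _ _ _.
have /andP[s0 sm] : (0 < s < m)%N by apply: lM; rewrite mem_nth // lS.
rewrite !ent_delta.
have [->|bj] := eqVneq (b : nat) j; last first.
  by rewrite !andbF subrr mulr0 mul0r.
have x0 a : (a < m)%N -> (a <= i.+1)%N -> (i <= a.+1)%N -> ent x a j = 0.
  move=> am ai ia; apply: (xn (Ordinal am)).
  suff : (depth i j <= (depth a j).+1)%N by move=> h; rewrite -ltnS; exact: leq_trans h.
  have [ea|ea|<-] := ltngtP a i; last exact: leqW.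
    by rewrite (_ : nat_of_ord i = a.+1) ?depth_succ //; lia.
  by rewrite (_ : a = i.+1) ?depth_pred //; lia.
rewrite !andbT; case: (eqVneq s i) => [si|si].
  by rewrite (x0 s) ?(x0 s.-1) ?subrr ?mulr0 //; lia.
case: (eqVneq s.-1 i) => [si'|si']; last by rewrite subrr mulr0 mul0r.
by rewrite (x0 s) ?(x0 s.-1) ?subrr ?mulr0 //; lia.
Qed.

(* Zeroing entry (i, j) of a minimizer together with the entry it is paired
   with in g does not increase g, because no two edges of calM are adjacent. *)
Lemma prox_zero eta xi zeta (i : 'I_m) (j : 'I_d) : 0 < eta ->
  prox eta (g_ P) xi zeta ->
  (forall a : 'I_m, (a <= i.+1)%N -> (i <= a.+1)%N -> ent xi a j = 0) ->
  ent zeta i j = 0.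
Proof.
move=> eta0 zprox xi0.
pose Z (a : nat) := [|| a == i, (a == i.+1) && (a \in calM m1 m2)
              | (a.+1 == i) && (nat_of_ord i \in calM m1 m2)].
pose z : 'cV[R]_(m * d) := \col_k
  if ((mxtens_unindex k).2 == j) && Z (mxtens_unindex k).1 then 0 else zeta k 0.
have zE (a : 'I_m) (b : 'I_d) :
    ent z a b = if (b == j) && Z a then 0 else ent zeta a b.
  by rewrite !entE mxE mxtens_indexK.
have Zi : Z i by rewrite /Z eqxx.
have gle : jump_l1 z <= jump_l1 zeta.
  rewrite /jump_l1 !big_seq; apply: ler_sum => s sM; apply: ler_sum => b _.
  have /andP[s0 sm] := calM_range m1_gt1 m2_gt0 sM.
  have sm' := leq_ltn_trans (leq_pred s) sm.
  rewrite !(zE (Ordinal sm)) !(zE (Ordinal sm')) /=.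
  case: (b == j) => //=.
  (* Both ends of an edge in [calM] are zeroed or neither is. *)
  suff -> : Z s = Z s.-1 by case: (Z s.-1); rewrite ?subrr ?normr0.
  have noadj := calM_nonconsecutive m1_gt1 m2_gt0.
  rewrite /Z (prednK s0); apply/idP/idP.
  - case/or3P => [/eqP si|/andP[/eqP si _]|/andP[/eqP si iM]].
    + by rewrite -si eqxx sM !orbT.
    + by rewrite si eqxx.
    + by case: (noadj _ sM); rewrite si.
  - case/or3P => [/eqP si|/andP[/eqP si sM']|/andP[/eqP si iM]].
    + by rewrite -si (prednK s0) eqxx sM !orbT.
    + by case: (noadj _ sM'); rewrite prednK.
    + by rewrite si eqxx.
have := zprox z; rewrite !g_instance // -!EFinD lee_fin => H.
have {}H : enorm (zeta - xi) ^+ 2 <= enorm (z - xi) ^+ 2.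
  have e20 : 0 < (2 * eta)^-1 by rewrite invr_gt0 mulr_gt0.
  have bg : beta * jump_l1 z <= beta * jump_l1 zeta by rewrite ler_pM2l.
  by rewrite -(ler_pM2l e20); lra.
(* As [xi] vanishes on the zeroed entries, zeroing removes their squares from the distance;
   minimality of [zeta] then forces the entry to be 0. *)
have : enorm (z - xi) ^+ 2 + ent zeta i j ^+ 2 <= enorm (zeta - xi) ^+ 2.
  have term (a : 'I_m) (b : 'I_d) :
    ent (z - xi) a b ^+ 2 + (if (a == i) && (b == j) then ent zeta i j ^+ 2 else 0)
      <= ent (zeta - xi) a b ^+ 2.
    rewrite !entB zE; case: (eqVneq b j) => [->|bj] /=; last by rewrite andbF addr0.
    rewrite andbT; case: ifPn => [Za|nZa].
      have xa : ent xi a j = 0.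
        by apply: xi0; case/or3P: Za => [/eqP ->|/andP[/eqP ->]|/andP[/eqP <-]] //; lia.
      rewrite xa !subr0 expr0n add0r; case: eqP => [->|_] //; exact: sqr_ge0.
    case: eqP => [ai|_]; last by rewrite addr0.
    by rewrite ai Zi in nZa.
  rewrite !sqr_enorm.
  have -> : ent zeta i j ^+ 2 = \sum_(a < m) \sum_(b < d)
      (if (a == i) && (b == j) then ent zeta i j ^+ 2 else 0).
    rewrite (bigD1 i) //= (bigD1 j) //= !eqxx /= !big1 ?addr0 //.
      by move=> a ai; rewrite big1 // => b _; rewrite (negbTE ai).
    by move=> b bj; rewrite (negbTE bj).
  rewrite -big_split; apply: ler_sum => a _; rewrite -big_split; apply: ler_sum => b _.
  exact: term.
move=> H'; apply/eqP; rewrite -sqrf_eq0 eq_le sqr_ge0 andbT; lra.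
Qed.

Lemma reached_prox n eta xi zeta : 0 < eta -> prox eta (g_ P) xi zeta ->
  reached n xi -> reached n.+1 zeta.
Proof.
move=> eta0 zp xin i j dij; apply: (prox_zero eta0 zp) => a ai ia.
apply: xin.
suff : (depth i j <= (depth a j).+1)%N by move=> h; rewrite -ltnS; exact: leq_trans h.
have [ea|ea|<-] := ltngtP a i; last exact: leqW.
  by rewrite (_ : nat_of_ord i = a.+1) ?depth_succ //; lia.
by rewrite (_ : nat_of_ord a = i.+1) ?depth_pred //; lia.
Qed.

Lemma linear_span_reached (y : nat -> 'cV[R]_(m * d)) t :
  y 0%N = 0 -> linear_span_assumption P y -> reached (2 * t) (y t).
Proof.
move=> y0 ylin; elim/ltn_ind: t => -[|t] IH; first by rewrite y0 => i j _; exact: ent0.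
have [xi [zeta [xiX [eta eta0 zp] yX]]] := ylin t.+1 isT.
have xir : reached (2 * t).+1 xi.
  apply: reached_span xiX _ => z; rewrite inE => /orP[/eqP->|].
    by rewrite mulmx0 => i j _; exact: ent0.
  move=> /flattenP[l /mapP[s]]; rewrite mem_iota add0n => st ->.
  have ys := IH _ st; have le2 : (2 * s <= 2 * t)%N by lia.
  rewrite !inE => /or3P[] /eqP ->.
  - by apply: reachedW ys; lia.
  - by apply: reachedW (reached_gradient ys); lia.
  - by apply: reachedW (reached_normal ys); lia.
apply: reached_span yX _ => z; rewrite !inE => /orP[] /eqP ->.
  by apply: reachedW xir; lia.
by apply: reachedW (reached_prox eta0 zp xir); lia.
Qed.

Lemma last_coord_zero (y : nat -> 'cV[R]_(m * d)) t (i : 'I_m) :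
  y 0%N = 0 -> linear_span_assumption P y -> (2 < d)%N ->
  (2 * t < (d - 2) * q)%N -> ent (y t) i d.-1 = 0.
Proof.
move=> y0 ylin d2 td; have dd : (d.-1 < d)%N by lia.
have /= := linear_span_reached (t := t) y0 ylin (i := i) (j := Ordinal dd); apply.
(* The last index d - 1 is even and positive, so the depth is (d - 2) q + (2q - i), smallest in the
   last third. *)
apply: leq_trans td _; rewrite /depth.
case: d d_odd d2 => [|[|[|e]]] //= oe _.
by rewrite !negbK in oe; rewrite oe /= subn2 /=; lia.
Qed.

End SupportPropagation.

(** * Stationary points *)

Section StationaryPoints.
Context {R : realType}.
Variables (eps Lf : R) (m1 m2 d : nat) (beta : R).
Hypotheses (eps_gt0 : 0 < eps) (Lf_gt0 : 0 < Lf) (m1_gt1 : (1 < m1)%N)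
  (m2_gt0 : (0 < m2)%N) (d_odd : odd d).
Local Notation m := (nblocks m1 m2).
Local Notation q := (m1 * m2)%N.
Local Notation P := (instP eps Lf m1 m2 d beta).
Local Notation sm := (Num.sqrt m%:R : R).
Local Notation A := (instA Lf m1 m2 d).
Local Notation Abar := (instAbar Lf m1 m2 d).
Local Notation C := (cst_out eps Lf m1 m2).
Local Notation sc := (cst_in eps Lf m1 m2).
Hypothesis beta_gt : (50 * pi + 1 + spectral_norm A) * sm * eps < beta.
Implicit Types x y z : 'cV[R]_(m * d).

Lemma sqrt_nblocks_gt0 : 0 < sm.
Proof. by rewrite sqrtr_gt0 nblocks_gt0R. Qed.

Lemma sqr_sqrt_nblocks : sm ^+ 2 = m%:R.
Proof. by rewrite sqr_sqrtr // ltW // nblocks_gt0R. Qed.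

Lemma beta_gt_scaled : (50 * pi + 1) * (sm * eps) < beta.
Proof.
apply: le_lt_trans beta_gt; rewrite -mulrA ler_wpM2r ?lerDl ?spectral_norm_ge0 //.
by rewrite mulr_ge0 ?sqrtr_ge0 // ltW.
Qed.

(** Cauchy-Schwarz obtained termwise from Young's inequality with the optimal parameter
    [c := K / sm]. *)
Lemma sum_abs_le (a : nat -> R) (K : R) : 0 < K ->
  \sum_(i < m) a i ^+ 2 <= K ^+ 2 -> \sum_(i < m) `|a i| <= sm * K.
Proof.
move=> K0 aK; have s0 := sqrt_nblocks_gt0.
pose c := K / sm.
have c0 : 0 < c by rewrite divr_gt0.
have term i : `|a i| <= a i ^+ 2 / (2 * c) + c / 2.
  rewrite -(real_normK (num_real (a i))) -subr_ge0.
  rewrite (_ : _ - _ = (`|a i| - c) ^+ 2 / (2 * c)); last by field; rewrite gt_eqF.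
  by rewrite divr_ge0 ?sqr_ge0 // mulr_ge0 // ltW.
apply: (@le_trans _ _ (\sum_(i < m) (a i ^+ 2 / (2 * c) + c / 2))).
  by apply: ler_sum => i _; exact: term.
rewrite big_split /= -mulr_suml sumr_const card_ord.
rewrite -[X in _ + X]mulr_natr.
apply: (@le_trans _ _ (K ^+ 2 / (2 * c) + c / 2 * m%:R)).
  by rewrite lerD2r ler_wpM2r // invr_ge0 mulr_ge0 // ltW.
rewrite le_eqVlt; apply/orP; left; apply/eqP; rewrite /c.
by move: (sm) sqr_sqrt_nblocks s0 => u <- u0; field; rewrite !gt_eqF.
Qed.

(** The test direction that jumps across edge s only. For s in [calM], or s = m where there is no
    jump, it lies in the kernel of A, so pairing the stationarity residual with it eliminates
    [gamma]. *)
Definition step_vec (s j : nat) : 'cV[R]_(m * d) :=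
  \col_k (((mxtens_unindex k).1 < s)%N && (nat_of_ord (mxtens_unindex k).2 == j))%:R.

Lemma ent_step_vec s j (i : 'I_m) (b : 'I_d) :
  ent (step_vec s j) i b = ((i < s)%N && (nat_of_ord b == j))%:R.
Proof. by rewrite entE mxE mxtens_indexK. Qed.

Lemma dotv_step_vec x s (j : 'I_d) :
  dotv x (step_vec s j) = \sum_(i < m | (i < s)%N) ent x i j.
Proof.
rewrite dotv_ent [RHS]big_mkcond; apply: eq_bigr => i _.
rewrite (bigD1 j) //= ent_step_vec eqxx andbT big1 ?addr0 => [|b bj].
  by case: (i < s)%N; rewrite ?mulr1 ?mulr0.
by rewrite ent_step_vec (negbTE (_ : (nat_of_ord b != j))) ?andbF ?mulr0.
Qed.

Lemma instA_step_vec s j :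
  s \in calM m1 m2 \/ s = m -> A *m step_vec s j = 0.
Proof.
move=> sM; apply: ent_inj => r b.
have lM := calMC_range m1_gt1 m2_gt0; have lS := size_calMC m1_gt1 m2_gt0.
rewrite ent_Jrows // ent0; set t := nth _ _ _.
have tMC : t \in calMC m1 m2 by rewrite mem_nth // lS.
have /andP[t0 tm] := lM _ tMC.
have tm' := leq_ltn_trans (leq_pred t) tm.
rewrite (ent_step_vec s j (Ordinal tm)) (ent_step_vec s j (Ordinal tm')) /=.
suff -> : (t < s)%N = (t.-1 < s)%N by rewrite subrr mulr0.
case: sM => [sM|->]; last by rewrite tm tm'.
have : t != s by apply: contraTneq tMC => ->; rewrite mem_filter sM.
by move=> ts; apply/idP/idP; lia.
Qed.

Lemma dotv_trmx k l (M : 'M[R]_(k, l)) (u : 'cV[R]_k) (w : 'cV[R]_l) :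
  dotv (M^T *m u) w = dotv u (M *m w).
Proof.
have dE n (y z : 'cV[R]_n) : dotv y z = (y^T *m z) 0 0.
  by rewrite mxE; apply: eq_bigr => i _; rewrite mxE.
by rewrite !dE trmx_mul trmxK mulmxA.
Qed.

Lemma dotvDl k (y z w : 'cV[R]_k) : dotv (y + z) w = dotv y w + dotv z w.
Proof. by rewrite /dotv -big_split; apply: eq_bigr => i _; rewrite mxE mulrDl. Qed.

Lemma dotvZr k (a : R) (y w : 'cV[R]_k) : dotv y (a *: w) = a * dotv y w.
Proof. by rewrite /dotv mulr_sumr; apply: eq_bigr => i _; rewrite mxE mulrCA. Qed.

Section FixedStationaryPoint.
Variables (x v : 'cV[R]_(m * d)) (gamma : 'cV[R]_((m - 3 * m2) * d)).
Hypothesis v_sub : subdiff (g_ P) x v.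
(** The distance to the set of residuals is an infimum; the slack 11/10 makes room for an actual
    subgradient [v]. *)
Hypothesis residual_le :
  enorm (gradient (f0_ P) x + A^T *m gamma + v) <= 11 / 10 * eps.
Hypothesis feasible : enorm (A *m x) <= eps.

Lemma residual_step s (j : 'I_d) : s \in calM m1 m2 \/ s = m ->
  `|dotv v (step_vec s j) + \sum_(i < m | (i < s)%N) ent (gradient (f0_ P) x) i j|
  <= 11 / 10 * (sm * eps).
Proof.
move=> sM; have := residual_le; set G := _ + _ + v => GK.
have -> : dotv v (step_vec s j) + \sum_(i < m | (i < s)%N) ent (gradient (f0_ P) x) i j
  = \sum_(i < m | (i < s)%N) ent G i j.
  rewrite -!dotv_step_vec /G !dotvDl dotv_trmx instA_step_vec //.
  rewrite [dotv gamma 0]big1 => [|k _]; first by rewrite addr0 addrC.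
  by rewrite mxE mulr0.
apply: le_trans (ler_norm_sum _ _ _) _.
apply: (@le_trans _ _ (\sum_(i < m) `|ent G i j|)).
  by rewrite big_mkcond; apply: ler_sum => i _; case: ifP.
rewrite mulrCA; apply: (sum_abs_le (a := fun i => ent G i j)).
  by rewrite mulr_gt0.
apply: (@le_trans _ _ (enorm G ^+ 2)).
  rewrite sqr_enorm exchange_big [leRHS](bigD1 j) //= lerDl sumr_ge0 // => b _.
  by rewrite sumr_ge0 // => i _; exact: sqr_ge0.
by rewrite ler_pXn2r ?nnegrE ?enorm_ge0 // mulr_ge0 // ltW.
Qed.

Lemma gradient_step_bound s (j : 'I_d) :
  `|\sum_(i < m | (i < s)%N) ent (gradient (f0_ P) x) i j|
  <= (24 + 24 * pi) * (sm * eps).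
Proof.
apply: le_trans (ler_norm_sum _ _ _) _.
apply: (@le_trans _ _ (\sum_(i < m) `|ent (gradient (f0_ P) x) i j|)).
  by rewrite big_mkcond; apply: ler_sum => i _; case: ifP.
apply: (@le_trans _ _ (\sum_(i < m) (C * sc * (12 + 12 * pi)))).
  apply: ler_sum => i _; rewrite gradient_instance //.
  apply: chain_partial_bound => [||k]; [exact/ltW/cst_out_gt0|exact/ltW/cst_in_gt0|].
  by rewrite wt_ge0 wt_le3.
have s0 := sqrt_nblocks_gt0.
rewrite sumr_const card_ord -[leLHS]mulr_natr cst_out_in //.
rewrite le_eqVlt; apply/orP; left; apply/eqP.
by move: (sm) (pi : R) sqr_sqrt_nblocks s0 => u p <- u0; field; rewrite gt_eqF.
Qed.

(** Shifting the blocks before s by the jump closes this gap and changes no other, which lowers [g]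
    by beta times the size of the jump. The subgradient inequality then gives beta <= |V|, where V
    pairs [v] with the step; but |V| is at most (24 + 24 pi + 11/10) sqrt m * eps, less than (50 pi
    + 1) sqrt m * eps. *)
Lemma exact_penalty s (j : 'I_d) : s \in calM m1 m2 -> ent x s j = ent x s.-1 j.
Proof.
move=> sM; apply/eqP; rewrite eq_sym -subr_eq0; apply/negPn/negP.
set a := _ - _ => a0.
have lM := calM_range m1_gt1 m2_gt0.
pose y := x - a *: step_vec s j.
have yE (i : 'I_m) (b : 'I_d) :
    ent y i b = ent x i b - a * ((i < s)%N && (nat_of_ord b == j))%:R.
  by rewrite entB entZ ent_step_vec.
pose T z t := \sum_(b < d) `|ent z t b - ent z t.-1 b|.
have Tle t : t \in calM m1 m2 ->
    T y t <= T x t - (if t == s then `|a| else 0).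
  move=> tM; have /andP[t0 tm] := lM _ tM.
  have tm' := leq_ltn_trans (leq_pred t) tm.
  have yt (b : 'I_d) : ent y t b - ent y t.-1 b = ent x t b - ent x t.-1 b
      + (if (t == s) && (b == j) then a else 0).
    rewrite (yE (Ordinal tm)) (yE (Ordinal tm')) /= -[b == j]/(nat_of_ord b == j).
    case: (eqVneq t s) => [ts|ts] /=.
      have -> : (t < s)%N = false by rewrite ts ltnn.
      have -> : (t.-1 < s)%N by rewrite -ts; lia.
      by case: eqP => _ /=; ring.
    have -> : (t < s)%N = (t.-1 < s)%N by apply/idP/idP; lia.
    by ring.
  rewrite /T; case: (eqVneq t s) => [ts|ts]; last first.
    rewrite subr0; apply: ler_sum => b _.
    by rewrite yt (negbTE ts) addr0.
  rewrite (bigD1 j) //= [X in _ <= X - _](bigD1 j) //= !yt ts !eqxx /=.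
  rewrite (_ : _ - _ + a = 0) ?normr0 ?add0r; last by rewrite /a; ring.
  rewrite -normrN opprB -/a addrAC subrr add0r; apply: ler_sum => b bj.
  by rewrite -ts yt (negbTE bj) andbF addr0.
have J : jump_l1 y + `|a| <= jump_l1 x.
  have JE z : jump_l1 z = T z s + \sum_(t <- rem s (calM m1 m2)) T z t.
    by rewrite /jump_l1 (big_rem s sM).
  have := Tle _ sM; rewrite eqxx => Ts.
  have : \sum_(t <- rem s (calM m1 m2)) T y t <= \sum_(t <- rem s (calM m1 m2)) T x t.
    rewrite !big_seq; apply: ler_sum => t /mem_rem tM; apply: le_trans (Tle _ tM) _.
    by case: ifP; rewrite ?subr0 // lerBlDr lerDl.
  by rewrite !JE; lra.
have := v_sub y; rewrite !g_instance // -EFinD lee_fin.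
rewrite (_ : y - x = - a *: step_vec s j); last by rewrite /y addrAC subrr add0r scaleNr.
rewrite dotvZr => H.
have := residual_step j (or_introl sM); have := gradient_step_bound s j.
set Gs := \sum_(i < m | _) _; set V := dotv v _ in H *.
have se : 0 < sm * eps by rewrite mulr_gt0 ?sqrt_nblocks_gt0.
move=> G1 G2; have p2 := pi_ge2 R.
have Vb : `|V| <= (24 + 24 * pi + 11 / 10) * (sm * eps).
  rewrite (_ : V = (V + Gs) - Gs); last by ring.
  by apply: le_trans (ler_normB _ _) _; lra.
have bV : beta * `|a| <= `|V| * `|a|.
  rewrite -normrM; apply: le_trans (ler_norm _).
  have b0 : 0 < beta by apply: lt_trans beta_gt_scaled; rewrite mulr_gt0 //; lra.
  have : beta * (jump_l1 y + `|a|) <= beta * jump_l1 x by rewrite ler_pM2l.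
  lra.
rewrite ler_pM2r ?normr_gt0 // in bV.
have := beta_gt_scaled; have := le_trans bV Vb.
move: se; set e := sm * eps; move=> e0 h1 h2.
have : (50 * pi + 1) * e < (24 + 24 * pi + 11 / 10) * e by exact: lt_le_trans h1.
rewrite ltr_pM2r //; lra.
Qed.

(** [g] is invariant under adding the same vector to all blocks, so [v] is orthogonal to such
    directions and drops out together with [gamma]. *)
Lemma total_gradient (j : 'I_d) :
  `|\sum_(i < m) ent (gradient (f0_ P) x) i j| <= 11 / 10 * (sm * eps).
Proof.
have := residual_step j (or_intror (erefl m)).
suff -> : dotv v (step_vec m j) = 0.
  by rewrite add0r (eq_bigl xpredT) // => i; rewrite ltn_ord.
have inv (a : R) : jump_l1 (x + a *: step_vec m j) = jump_l1 x.
  rewrite /jump_l1 !big_seq; apply: eq_bigr => t tM; apply: eq_bigr => b _.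
  have /andP[t0 tm] := calM_range m1_gt1 m2_gt0 tM.
  have tm' := leq_ltn_trans (leq_pred t) tm.
  rewrite !entD !entZ (ent_step_vec m j (Ordinal tm)) (ent_step_vec m j (Ordinal tm')) /=.
  by rewrite tm tm'; congr `| _ |; ring.
have H (a : R) : a * dotv v (step_vec m j) <= 0.
  have := v_sub (x + a *: step_vec m j); rewrite !g_instance // inv -EFinD lee_fin.
  by rewrite addrAC subrr add0r dotvZr; lra.
by have := H 1; have := H (-1); lra.
Qed.

(** Edges in [calM] carry no jump, so feasibility alone bounds the energy of the whole path by (eps
    / (m Lf))^2; a path of at most m edges multiplies this by m. *)
Lemma entry_gap (i r : 'I_m) j : `|ent x i j - ent x r j| <= eps / (sm * Lf).
Proof.
have s0 := sqrt_nblocks_gt0.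
have [dj|jd] := leqP d j.
  by rewrite !ent_out // subrr normr0 divr_ge0 ?mulr_ge0 // ltW.
rewrite -(@ler_pXn2r _ 2) ?nnegrE ?divr_ge0 ?mulr_ge0 ?(ltW s0) ?(ltW Lf_gt0) ?(ltW eps_gt0) //.
rewrite real_normK ?num_real //.
apply: le_trans (sqr_diff_le (fun k => ent x k j) (ltn_ord i) (ltn_ord r)) _.
have mL : 0 < (m%:R * Lf) ^+ 2 by rewrite exprn_gt0 // mulr_gt0 // nblocks_gt0R.
have E : (m%:R * Lf) ^+ 2 * edge_energy x <= eps ^+ 2.
  rewrite -sqr_enorm_stacked //.
  have -> : Abar *m x = 0.
    apply: ent_inj => k b; rewrite ent_Jrows ?size_calM ?ent0 //; last exact: calM_range.
    rewrite exact_penalty ?subrr ?mulr0 // mem_nth // size_calM.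
    exact: ltn_ord.
  rewrite /enorm [X in Num.sqrt X](_ : _ = 0) ?sqrtr0 ?expr0n ?add0r; last first.
    by rewrite big1 // => k _; rewrite mxE expr0n.
  by rewrite ler_pXn2r ?nnegrE ?enorm_ge0 // ltW.
have E' : \sum_(1 <= s < m) (ent x s j - ent x s.-1 j) ^+ 2 <= edge_energy x.
  rewrite /edge_energy (bigD1 (Ordinal jd)) //= lerDl sumr_ge0 // => b _.
  by rewrite sumr_ge0 // => s _; exact: sqr_ge0.
apply: (@le_trans _ _ (m%:R * edge_energy x)).
  by rewrite ler_pM2l // nblocks_gt0R.
rewrite -(ler_pM2l mL) mulrCA.
apply: (@le_trans _ _ (m%:R * eps ^+ 2)).
  by rewrite ler_pM2l // nblocks_gt0R.
rewrite le_eqVlt; apply/orP; left; apply/eqP.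
by move: (sm) sqr_sqrt_nblocks s0 => u <- u0; field; rewrite !gt_eqF.
Qed.

(* Block r is used as a common reference point for all blocks; the first
   coordinate of it that is less than 1 in absolute value has a large total
   partial derivative. *)
Lemma fixed_stationary_large (r : 'I_m) (j : 'I_d) : 1 <= `|chain sc x r j.+1|.
Proof.
have s0 := sqrt_nblocks_gt0; have p0 := pi_gt0 R; have p2 := pi_ge2 R.
have se : 0 < sm * eps by rewrite mulr_gt0.
have C0 := ltW (cst_out_gt0 eps_gt0 Lf_gt0 m1_gt1 m2_gt0).
have sc0 := ltW (cst_in_gt0 eps_gt0 Lf_gt0 m1_gt1 m2_gt0).
have Csm : m%:R * (C * sc) = 2 * (sm * eps).
  rewrite cst_out_in //.
  by move: (sm) sqr_sqrt_nblocks s0 => u <- u0; field; rewrite gt_eqF.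
pose z := chain sc x r.
case: j => j; elim/ltn_ind: j => j IH jd /=; rewrite leNgt; apply/negP => zj.
have zj' : 1 <= `|z j|.
  case: j IH jd zj => [|j] IH jd zj; first by rewrite /= normr1.
  exact: (IH j (ltnSn j) (ltnW jd)).
(* With all blocks frozen at block r the weights enter only through their sum, and the [chia] term,
   being nonpositive, works in the desired direction. *)
pose S := \sum_(i < m) chain_partial C sc (wt q d i) z j.
have S_lt : S < - (21 / 10) * (sm * eps).
  have SE : S = C * sc * (m%:R * chib (z j) (z j.+1)
       + (\sum_(i < m) wt q d i j.+1) * chia (z j.+1) (z j.+2)).
    rewrite /S -mulr_sumr; congr (_ * _); rewrite big_split /= -!mulr_suml.
    congr (_ * _ + _); rewrite -[RHS](_ : \sum_(i < 3 * q) wt q d i j = _).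
      by rewrite -nblocksE.
    by rewrite sum_wt // nblocksE.
  have Wge : 0 <= \sum_(i < m) (wt q d i j.+1 : R).
    by apply: sumr_ge0 => i _; exact: wt_ge0.
  have wle : (\sum_(i < m) wt q d i j.+1) * chia (z j.+1) (z j.+2) <= 0.
    by rewrite mulr_ge0_le0 // chia_le0.
  have cl : chib (z j) (z j.+1) < - (21 / 20) by exact: chib_lt.
  apply: (@le_lt_trans _ _ (C * sc * (m%:R * chib (z j) (z j.+1)))).
    rewrite SE; apply: ler_wpM2l; first exact: mulr_ge0.
    by rewrite gerDl.
  rewrite mulrA [C * sc * _]mulrC Csm.
  have := se; nra.
have gap : `|\sum_(i < m) ent (gradient (f0_ P) x) i (Ordinal jd) - S| <= sm * eps.
  rewrite /S -sumrB; apply: le_trans (ler_norm_sum _ _ _) _.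
  (* This is [sc] times the bound of [entry_gap]. *)
  pose B := (150 * pi)^-1 : R.
  have chain_gap (i : 'I_m) k : `|chain sc x i k - z k| <= B.
    case: k => [|k]; rewrite /z /=.
      by rewrite subrr normr0 invr_ge0 mulr_ge0 // ltW.
    rewrite -mulrBr normrM (ger0_norm sc0).
    apply: le_trans (ler_wpM2l sc0 (entry_gap i r k)) _.
    rewrite /cst_in /B le_eqVlt; apply/orP; left; apply/eqP.
    move: (sm) (pi : R) s0 p0 => u p u0 p0.
    by field; rewrite !gt_eqF.
  apply: (@le_trans _ _ (\sum_(i < m) (C * sc * ((36 + 24 * pi) * B)))).
    apply: ler_sum => i _; rewrite gradient_instance //.
    apply: le_trans (chain_partial_lipschitz _ _ _ _ _ _) _ => // [k|].
      by rewrite wt_ge0 wt_le3.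
    apply: ler_wpM2l; first exact: mulr_ge0.
    have := chain_gap i j; have := chain_gap i j.+1; have := chain_gap i j.+2.
    move=> /= g2 g1 g0.
    have g1' : (12 + 24 * pi) * `|chain sc x i j.+1 - z j.+1| <= (12 + 24 * pi) * B.
      by rewrite ler_wpM2l //; lra.
    by move: g1'; rewrite /=; lra.
  rewrite sumr_const card_ord -[leLHS]mulr_natl mulrA Csm.
  rewrite [leLHS](_ : _ = (36 + 24 * pi) * B * 2 * (sm * eps)); last by ring.
  (* 72 + 48 pi <= 150 pi. *)
  rewrite -[leRHS]mul1r ler_pM2r // /B mulrAC ler_pdivrMr ?mulr_gt0 //; lra.
have T := total_gradient (Ordinal jd).
move: gap T S_lt; rewrite !ler_norml => /andP[g1 g2] /andP[t1 t2].
lra.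
Qed.

End FixedStationaryPoint.

Lemma stationary_large x (i : 'I_m) (j : 'I_d) :
  eps_stationary eps P x -> 1 <= `|chain sc x i j.+1|.
Proof.
have eps_lt : eps < 11 / 10 * eps.
  by rewrite -[ltLHS]mul1r ltr_pM2r // ltr_pdivlMr // mul1r ltr_nat.
move=> [gamma]; rewrite ge_max => /andP[/= D F].
have : (ereal_inf [set (enorm (gradient (f0_ P) x + A^T *m gamma + v))%R%:E
         | v in subdiff (g_ P) x] < (11 / 10 * eps)%R%:E)%E.
  by apply: le_lt_trans D _; rewrite lte_fin.
move=> /ereal_inf_lt[_ [v vs <-]]; rewrite lte_fin => /ltW vr.
apply: fixed_stationary_large vs vr _ i j.
by move: F; rewrite addr0 lee_fin.
Qed.

End StationaryPoints.

(** * Lower bound *)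

Section Main.
Context {R : realType}.
Variables (eps Lf : R) (m1 m2 d : nat) (beta : R).
Hypotheses (eps_gt0 : 0 < eps) (Lf_gt0 : 0 < Lf) (m1_gt1 : (1 < m1)%N)
  (m2_gt0 : (0 < m2)%N) (d_odd : odd d) (beta_gt0 : 0 < beta).
Variable x0 : 'cV[R]_(nblocks m1 m2 * d).
Local Notation m := (nblocks m1 m2).
Local Notation q := (m1 * m2)%N.
Local Notation P0 := (instP eps Lf m1 m2 d beta).
Local Notation P := (recenter x0 P0).
Local Notation C := (cst_out eps Lf m1 m2).
Local Notation sc := (cst_in eps Lf m1 m2).

Lemma recentered_gradient_lipschitz x y :
  enorm (gradient (f0_ P) x - gradient (f0_ P) y) <= Lf * enorm (x - y).
Proof.
have gE z : gradient (f0_ P) z = gradient (f0_ P0) (z - x0) := gradient_shift _ _ _.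
rewrite !gE (f0_instance _ _ _ _ _ d_odd).
have C0 := ltW (cst_out_gt0 eps_gt0 Lf_gt0 m1_gt1 m2_gt0).
have sc0 := ltW (cst_in_gt0 eps_gt0 Lf_gt0 m1_gt1 m2_gt0).
have := gradient_chain_lipschitz C0 sc0 (@wt_ge0 R q d) (@wt_le3 R q d) _ (x - x0) (y - x0).
rewrite (_ : x - x0 - (y - x0) = x - y); last by rewrite opprB addrA subrK.
move=> H; apply: le_trans (H _) _ => [i j dj|]; first by rewrite /wt dj.
rewrite ler_wpM2r ?enorm_ge0 // cst_out_in2 //.
have p2 := pi_ge2 R; have p0 := pi_gt0 R.
rewrite mulrAC ler_pdivrMr ?mulr_gt0 // ler_pM2l //; lra.
Qed.

Lemma recentered_is_problem : is_problem P.
Proof.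
split.
- move=> x.
  have dshift : differentiable (fun y : 'cV[R]_(m * d) => y - x0) x.
    exact: differentiableB.
  have df0 : differentiable (f0_ P0) (x - x0).
    rewrite (f0_instance _ _ _ _ _ d_odd).
    exact: differentiable_chain_potential.
  exact: differentiable_comp dshift df0.
- exact: continuous_enorm_lipschitz recentered_gradient_lipschitz.
- rewrite (_ : g_ P = fun x =>
     (beta / (m%:R * Lf)
      * l1norm (instAbar Lf m1 m2 d *m x + - (instAbar Lf m1 m2 d *m x0)))%:E).
    apply: proper_lsc_convex_l1; rewrite divr_ge0 ?mulr_ge0 // ltW //.
  by apply/funext => x; rewrite /= mulmxBr.
Qed.

(** Every link is at least - 4 pi, the weights add up to m * d, and [g] is nonnegative. *)
Lemma F0_ge x : ((- (4 * pi * C * (m%:R * d%:R)))%:E <= F0 P x)%E.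
Proof.
have -> : F0 P x = F0 P0 (x - x0) by [].
rewrite /F0 (f0_instance _ _ _ _ _ d_odd) g_instance //.
rewrite -EFinD lee_fin -[leLHS]addr0 lerD //.
  apply: chain_potential_ge => //; first exact/ltW/cst_out_gt0.
  - by move=> i j; exact: wt_ge0.
  - rewrite exchange_big /=; under eq_bigr => j _.
      rewrite (_ : \sum_(i < m) _ = \sum_(i < 3 * q) wt q d i j); last by rewrite -nblocksE.
      rewrite sum_wt // -nblocksE.
      over.
    by rewrite sumr_const card_ord mulr_natr.
by rewrite mulr_ge0 ?(ltW beta_gt0) // sumr_ge0 // => s _; rewrite sumr_ge0.
Qed.

Lemma Delta_le : Delta_F0 P x0 <= 1200 * pi ^+ 2 * eps ^+ 2 * d%:R / Lf.
Proof.
have M0 := @nblocks_gt0R R m1 m2 m1_gt1 m2_gt0.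
have -> : 1200 * pi ^+ 2 * eps ^+ 2 * d%:R / Lf = 4 * pi * C * (m%:R * d%:R).
  rewrite /cst_out; move: (pi : R) => p; move: (m%:R : R) (d%:R : R) M0 => M D M0.
  by field; rewrite !gt_eqF.
set K := 4 * _ * _ * _.
have F0x0 : F0 P x0 = (f0_ P0 0)%:E.
  have -> : F0 P x0 = F0 P0 (x0 - x0) by [].
  rewrite /F0 g_instance // subrr.
  rewrite -EFinD /jump_l1 big1 ?mulr0 ?addr0 // => s _.
  by rewrite big1 // => j _; rewrite !ent0 subrr normr0.
have I1 : ((- K)%:E <= ereal_inf (range (F0 P)))%E.
  by apply: le_ereal_inf_tmp => _ [x _ <-]; exact: F0_ge.
have I2 : (ereal_inf (range (F0 P)) <= F0 P x0)%E by apply: ereal_inf_lbound; exists x0.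
have f00 : f0_ P0 0 <= 0.
  rewrite (f0_instance _ _ _ _ _ d_odd); apply: chain_potential0_le0; first exact/ltW/cst_out_gt0.
  by move=> i j; exact: wt_ge0.
rewrite /Delta_F0 F0x0; move: I1 I2 f00; rewrite F0x0; move: (f0_ P0 0) => a.
case: (ereal_inf _) => [r| |] //=.
by rewrite !lee_fin; lra.
Qed.

Lemma recentered_structural : structural_assumption Lf P.
Proof.
split.
- exact: recentered_gradient_lipschitz.
- apply: (@lt_le_trans _ _ (- (4 * pi * C * (m%:R * d%:R)))%:E); first exact: ltNyr.
  by apply: le_ereal_inf_tmp => _ [x _ <-]; exact: F0_ge.
- by move=> x /=; rewrite mulmxBr sub0r.
- rewrite (_ : gbar_ P = fun y => (beta / (m%:R * Lf) * l1norm (1%:M *m y + 0))%:E).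
    by apply: proper_lsc_convex_l1; rewrite divr_ge0 ?mulr_ge0 // ltW.
  by apply/funext => y; rewrite mul1mx addr0.
Qed.

Lemma kappa_Delta_le (t : nat) : (5 <= d)%N -> ((d - 2) * q <= 2 * t)%N ->
  kappa (col_mx (Abar_ P) (A_ P)) * Lf * Delta_F0 P x0
    / (36 * 10 ^+ 3 * pi ^+ 2) * eps ^- 2 <= t%:R.
Proof.
move=> d5 dt.
have k0 : 0 <= kappa (col_mx (Abar_ P) (A_ P)) by exact: sqrtr_ge0.
have kle : kappa (col_mx (Abar_ P) (A_ P)) <= 2 * m%:R by exact: kappa_instance.
have p0 := pi_gt0 R.
set k := kappa _ in k0 kle *.
apply: (@le_trans _ _ (k * d%:R / 30)).
  have -> : k * d%:R / 30 = k * Lf * (1200 * pi ^+ 2 * eps ^+ 2 * d%:R / Lf)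
      / (36 * 10 ^+ 3 * pi ^+ 2) * eps ^- 2.
    by move: (pi : R) p0 => p p0; field; rewrite !gt_eqF.
  apply: ler_wpM2r; first by rewrite invr_ge0 sqr_ge0.
  apply: ler_wpM2r; first by rewrite invr_ge0 mulr_ge0 ?sqr_ge0.
  by apply: ler_wpM2l; [rewrite mulr_ge0 // ltW|exact: Delta_le].
apply: (@le_trans _ _ (2 * m%:R * d%:R / 30)).
  by rewrite ler_pM2r // ler_wpM2r.
(* With 36000 = 1200 * 30 and m = 3q, what remains is 6 q d <= 30 t; it follows from 6 d <= 15 (d -
   2), true for d >= 5. *)
rewrite ler_pdivrMr // -!natrM ler_nat nblocksE.
by nia.
Qed.

(** If the last coordinate is still 0 in every block, each of the m blocks is off by at least 1 /
    [sc], so the distance is at least sqrt m / [sc] = 150 pi eps / Lf: the threshold for omega. *)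
Lemma close_to_stationary_late (x : nat -> 'cV[R]_(m * d)) (omega : R) t xstar :
  (50 * pi + 1 + spectral_norm (instA Lf m1 m2 d)) * Num.sqrt m%:R * eps < beta ->
  omega < 150 * pi * eps / Lf -> (5 <= d)%N -> x 0%N = x0 ->
  linear_span_assumption P0 (fun t => x t - x0) ->
  eps_stationary eps P xstar -> omega_close omega (x t) xstar ->
  ((d - 2) * q <= 2 * t)%N.
Proof.
move=> beta_gt om d5 xx0 xlin /eps_stationary_recenter xst close.
rewrite leqNgt; apply/negP => td.
have dd : (d.-1 < d)%N by lia.
have sc0 := cst_in_gt0 eps_gt0 Lf_gt0 m1_gt1 m2_gt0.
have M0 := @nblocks_gt0R R m1 m2 m1_gt1 m2_gt0.
have z0 (i : 'I_m) : ent (x t - x0) i d.-1 = 0.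
  apply: last_coord_zero xlin _ td => //; last by lia.
  by rewrite xx0 subrr.
have big (i : 'I_m) : 1 <= sc ^+ 2 * ent (x t - xstar) i d.-1 ^+ 2.
  have := stationary_large eps_gt0 Lf_gt0 m1_gt1 m2_gt0 d_odd beta_gt i (Ordinal dd) xst.
  have -> : ent (x t - xstar) i d.-1 = - ent (xstar - x0) i d.-1.
    by have := z0 i; rewrite !entB; lra.
  rewrite /= sqrrN -exprMn => h.
  by rewrite -real_normK ?num_real // expr_ge1.
have H : m%:R <= sc ^+ 2 * enorm (x t - xstar) ^+ 2.
  rewrite sqr_enorm mulr_sumr -[m in leLHS]card_ord -sumr_const.
  apply: ler_sum => i _; apply: le_trans (big i) _.
  rewrite ler_wpM2l ?sqr_ge0 // (bigD1 (Ordinal dd)) //= lerDl sumr_ge0 // => b _.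
  exact: sqr_ge0.
have lt : sc * enorm (x t - xstar) < Num.sqrt m%:R.
  apply: (@le_lt_trans _ _ (sc * omega)); first by rewrite ler_pM2l.
  have -> : Num.sqrt m%:R = sc * (150 * pi * eps / Lf).
    rewrite /cst_in; have := pi_gt0 R; move: (Num.sqrt _) (pi : R) => u p p0.
    by field; rewrite !gt_eqF.
  by rewrite ltr_pM2l.
move: H; rewrite leNgt => /negP; apply.
rewrite -exprMn -[ltRHS](sqr_sqrtr (ltW M0)) ltr_pXn2r ?nnegrE ?sqrtr_ge0 //.
by rewrite mulr_ge0 ?enorm_ge0 // ltW.
Qed.

End Main.

Theorem theorem2p1 (R : realType) (eps Lf : R) (m1 m2 dbar : nat) (beta : R)
    (eps_gt0 : 0 < eps) (Lf_gt0 : 0 < Lf)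
    (m1_ge2 : (2 <= m1)%N) (m1_even : ~~ odd m1) (m2_ge1 : (1 <= m2)%N)
    (dbar_ge5 : (5 <= dbar)%N) (dbar_odd : odd dbar)
    (beta_gt : (50 * pi + 1 + spectral_norm (instA Lf m1 m2 dbar))
               * Num.sqrt (nblocks m1 m2)%:R * eps < beta)
    (omega : R) (omega_ge0 : 0 <= omega)
    (omega_lt : omega < 150 * pi * eps / Lf)
    (x0 : 'cV[R]_(nblocks m1 m2 * dbar)) :
  let P := recenter x0 (instP eps Lf m1 m2 dbar beta) in
  [/\ is_problem P,
      structural_assumption Lf P &
      forall x : nat -> 'cV[R]_(nblocks m1 m2 * dbar),
        x 0%N = x0 ->
        linear_span_assumption (instP eps Lf m1 m2 dbar beta) (fun t => x t - x0) ->
        forall (t : nat) (xstar : 'cV[R]_(nblocks m1 m2 * dbar)),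
          eps_stationary eps P xstar ->
          omega_close omega (x t) xstar ->
          Num.ceil (kappa (col_mx (Abar_ P) (A_ P)) * Lf * Delta_F0 P x0
                    / (36 * 10 ^+ 3 * pi ^+ 2) * eps ^- 2) <= t%:Z].
Proof.
move=> P.
have beta_gt0 : 0 < beta.
  apply: le_lt_trans beta_gt; rewrite !mulr_ge0 ?sqrtr_ge0 ?(ltW eps_gt0) //.
  by rewrite addr_ge0 ?spectral_norm_ge0 // addr_ge0 // mulr_ge0 ?pi_ge0.
split; [exact: recentered_is_problem|exact: recentered_structural|].
move=> x xx0 xlin t xstar xst close.
rewrite real_ceil_le_int ?num_real //; apply: kappa_Delta_le => //.
exact: close_to_stationary_late beta_gt omega_lt dbar_ge5 xx0 xlin xst close.
Qed.
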